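(* Let $k=2$ and $n\geqslant 2$. (a) The maximum of $\operatorname{vol}([-1,1]^n\cap H_2)$ over all $2$-dimensional subspaces $H_2\subset\mathbb{R}^n$ is attained on subspaces $H_2$ such that $[-1,1]^n\cap H_2$ is an affine cube (a parallelogram), i.e. $\operatorname{vol}([-1,1]^n\cap H_2)\leqslant C_{\mathrm{cube}}(n,2)\,2^2$. (b) The minimum of $\operatorname{vol}(B_1^n\mid H_2)$ over all $2$-dimensional subspaces $H_2\subset\mathbb{R}^n$ is attained on subspaces $H_2$ such that $B_1^n\mid H_2$ is an affine cross-polytope, i.e. $\operatorname{vol}(B_1^n\mid H_2)\geqslant C_{\mathrm{cross}}(n,2)\,\frac{2^2}{2!}$.
   Context: $B_1^n=\{x\in\mathbb{R}^n\mid |x_1|+\cdots+|x_n|\leqslant 1\}$ is the standard cross-polytope and $[-1,1]^n$ the standard cube; $K\mid H$ denotes orthogonal projection onto $H$ and $\operatorname{vol}$ is the volume in the subspace. For a $k$-dimensional subspace, $C_{\mathrm{cube}}(n,k)\,2^k$ is defined as the maximum volume of a section $[-1,1]^n\cap H_k$ over those $k$-dimensional subspaces $H_k$ for which $[-1,1]^n\cap H_k$ is an affine cube, and $C_{\mathrm{cross}}(n,k)\,\frac{2^k}{k!}$ is defined as the minimum volume of a projection $B_1^n\mid H_k$ over those $H_k$ for which $B_1^n\mid H_k$ is an affine cross-polytope. *)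

(* Defs.v *)
From HB Require Import structures.
From mathcomp Require Import all_boot all_order all_algebra.
From mathcomp Require Import all_classical all_reals all_analysis.
Set Implicit Arguments. Unset Strict Implicit. Unset Printing Implicit Defensive.
Import Order.TTheory GRing.Theory Num.Theory.
Local Open Scope classical_set_scope.
Local Open Scope ring_scope.

(* Points of R^n are functions 'I_n -> R.  A 2-dimensional subspace H of R^n
   is given by an orthonormal basis (u, v); the map (s,t) |-> s u + t v is a
   linear isometry R^2 -> H, so 2-dimensional volume in H is the Lebesgue
   measure in R^2 = R * R of the coordinate image. *)

Definition orthonormal2 (R : realType) (n : nat) (u v : 'I_n -> R) : Prop :=
  \sum_(i < n) u i ^+ 2 = 1 /\ \sum_(i < n) v i ^+ 2 = 1 /\
  \sum_(i < n) u i * v i = 0.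

Definition area (R : realType) (S : set (R * R)) : \bar R :=
  ((@lebesgue_measure R) \x (@lebesgue_measure R))%E S.

Definition cube (R : realType) (n : nat) : set ('I_n -> R) :=
  [set x | forall i, -1 <= x i <= 1].

Definition cross (R : realType) (n : nat) : set ('I_n -> R) :=
  [set x | \sum_(i < n) `|x i| <= 1].

Definition section_coords (R : realType) (n : nat) (K : set ('I_n -> R))
  (u v : 'I_n -> R) : set (R * R) :=
  [set p | K (fun i => p.1 * u i + p.2 * v i)].

Definition proj_coords (R : realType) (n : nat) (K : set ('I_n -> R))
  (u v : 'I_n -> R) : set (R * R) :=
  [set p | exists2 x, K x &
     p = (\sum_(i < n) x i * u i, \sum_(i < n) x i * v i)].

Definition square2 (R : realType) : set (R * R) :=
  [set y | -1 <= y.1 <= 1 /\ -1 <= y.2 <= 1].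
Definition cross2 (R : realType) : set (R * R) :=
  [set y | `|y.1| + `|y.2| <= 1].

Definition affine_image_of (R : realType) (K0 S : set (R * R)) : Prop :=
  exists (c : R * R) (a b c' d : R), a * d - b * c' != 0 /\
    S = [set (c.1 + a * y.1 + b * y.2, c.2 + c' * y.1 + d * y.2) | y in K0].

Definition affine_cube2 (R : realType) (S : set (R * R)) : Prop :=
  affine_image_of (@square2 R) S.
Definition affine_cross2 (R : realType) (S : set (R * R)) : Prop :=
  affine_image_of (@cross2 R) S.

(* Main.v *)
(* Write [w_i = (u_i, v_i)], so that the section is the polar of the hull [K] of
   the points [+-w_i].  By Cauchy-Binet orthonormality of [(u, v)] yields
   [\sum_(i < j) det(w_i, w_j)^2 = 1], so both parts reduce to bounding this sum
   by [floor (n^2 / 4)] times the square of a normalised area; the bound is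
   attained when half of the [w_i] point along each axis.
   As in Mantel's theorem, one deletes a pair [i, j] maximising
   [|det(w_i, w_j)|] and shows that
   [det(w_k, w_i)^2 + det(w_k, w_j)^2] is at most the normalised value 1 for
   every other [k].
   For the projection this follows from
   [|det(w_i, w_j)| + |det(w_j, w_k)| + |det(w_k, w_i)| <= area K].
   For the section, take [w_i, w_j] as a basis; the section becomes the square
   [-1, 1]^2 with corners cut off by the other constraints.  If the cuts
   are small, the deletion step works.  If they are large, they are concentrated
   on one pair of opposite corners, all the [w_k] lie in an explicit ellipse, and
   comparing trace and determinant of their Gram matrix in the metric of that
   ellipse bounds the sum directly. *)
Require Import Defs.
From HB Require Import structures.
From mathcomp Require Import all_boot all_order all_algebra.
From mathcomp Require Import all_classical all_reals all_analysis.
From mathcomp Require Import measurable_realfun zify ring lra.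
Set Implicit Arguments. Unset Strict Implicit. Unset Printing Implicit Defensive.
Import Order.TTheory GRing.Theory Num.Theory.
Local Open Scope ring_scope.

(** * Scalar inequalities *)

(* Twice the area of the corner cut off the square [-1, 1]^2 by the line
   [|a| x + |b| y = 1], when [|a|] and [|b|] are at most 1. *)
Definition corner_cut (R : realFieldType) (a b : R) : R :=
  if 1 < `|a| + `|b| then (`|a| + `|b| - 1) ^+ 2 / (`|a| * `|b|) else 0.

Lemma corner_cut_ge0 (R : realFieldType) (a b : R) : 0 <= corner_cut a b.
Proof.
by rewrite /corner_cut; case: ifP => // _; rewrite divr_ge0 ?sqr_ge0 ?mulr_ge0.
Qed.

Lemma corner_cut_le1 (R : realFieldType) (a b : R) : `|a| <= 1 -> `|b| <= 1 ->
  corner_cut a b <= 1.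
Proof.
rewrite /corner_cut; have := normr_ge0 b; have := normr_ge0 a.
move: `|a| `|b| => {}a {}b a0 b0 a1 b1; case: ltP => // ab.
have p0 : 0 < a * b by rewrite mulr_gt0//; lra.
by rewrite ler_pdivrMr//; nra.
Qed.

(** Write [a], [b] for the absolute values. After clearing denominators the difference has the
    factor [(1 - a) * (1 - b)]. With [e = a + b - 1] and [p = a * b] the cofactor
    [2 p^2 - e^2 p - e^3] is nonnegative because [0 < e <= 1] and [e <= p]. *)
Lemma sum_sqr_le_cut (R : realFieldType) (a b : R) : `|a| <= 1 -> `|b| <= 1 ->
  a ^+ 2 + b ^+ 2 <= 1 + corner_cut a b ^+ 2.
Proof.
rewrite -(real_normK (num_real a)) -(real_normK (num_real b)) /corner_cut.
have := normr_ge0 b; have := normr_ge0 a.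
move: `|a| `|b| => {}a {}b a0 b0 a1 b1; case: ltP => ab; last by nra.
have p0 : 0 < a * b by rewrite mulr_gt0//; lra.
rewrite expr_div_n -lerBlDl ler_pdivlMr ?exprn_gt0// -subr_ge0.
have -> : (a + b - 1) ^+ 2 ^+ 2 - (a ^+ 2 + b ^+ 2 - 1) * (a * b) ^+ 2 =
  (1 - a) * (1 - b) *
  (2 * (a * b) ^+ 2 - (a + b - 1) ^+ 2 * (a * b) - (a + b - 1) ^+ 3) by ring.
have : a + b - 1 <= a * b by nra.
have : 0 < a + b - 1 by lra.
have : a + b - 1 <= 1 by lra.
move: (a * b) (a + b - 1) => p e e1 e0 ep.
apply: mulr_ge0; first by apply: mulr_ge0; lra.
have h1 : e ^+ 2 * p <= p ^+ 2.
  rewrite [leRHS]expr2 ler_wpM2r//; first lra.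
  by rewrite expr2; nra.
have h2 : e ^+ 3 <= p ^+ 2.
  rewrite exprS; have : e ^+ 2 <= p ^+ 2 by rewrite ler_sqr ?nnegrE//; lra.
  have : 0 <= e ^+ 2 by rewrite sqr_ge0.
  nra.
lra.
Qed.

(** The ellipse [x^2 + y^2 - (1 - c) x y = 1 + c] passes through the corners [(1, 1)] and [(-1, -1)]
    and encloses the two quadrants of [[-1, 1]^2] at these corners. *)
Lemma ellipse_opposite (R : realFieldType) (a b c : R) :
  `|a| <= 1 -> `|b| <= 1 -> 0 <= c <= 1 -> 0 <= a * b ->
  a ^+ 2 + b ^+ 2 - (1 - c) * (a * b) <= 1 + c.
Proof.
move=> a1 b1 /andP[c0 c1] ab; move: (ab); rewrite -(ger0_norm ab) normrM.
rewrite -(real_normK (num_real a)) -(real_normK (num_real b)).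
have := normr_ge0 b; have := normr_ge0 a; move: a1 b1 {ab}.
move: `|a| `|b| => {}a {}b a1 b1 a0 b0 ab.
have : c * (a * b) <= c by rewrite ler_piMr//; nra.
have : a ^+ 2 + b ^+ 2 - a * b <= 1 by case: (lerP a b) => h; nra.
lra.
Qed.

(** In the other two quadrants a bound on the cut keeps the point in the same ellipse. The key is an
    identity in the absolute values whose right-hand side is a square. *)
Lemma ellipse_cut (R : realFieldType) (a b c : R) :
  `|a| <= 1 -> `|b| <= 1 -> 0 <= c <= 1 -> a * b <= 0 -> corner_cut a b <= c ->
  a ^+ 2 + b ^+ 2 - (1 - c) * (a * b) <= 1 + c.
Proof.
move=> a1 b1 /andP[c0 c1] ab.
have -> : a * b = - (`|a| * `|b|) by rewrite -normrM ler0_norm// opprK.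
rewrite /corner_cut -(real_normK (num_real a)) -(real_normK (num_real b)).
have := normr_ge0 b; have := normr_ge0 a; move: a1 b1 {ab}.
move: `|a| `|b| => {}a {}b a1 b1 a0 b0.
case: ltP => ab.
  have p0 : 0 < a * b by rewrite mulr_gt0//; lra.
  rewrite ler_pdivrMr// => h.
  rewrite -(ler_pM2l p0).
  have : (1 + a * b) * (a + b - 1) ^+ 2 - a * b * (a ^+ 2 + b ^+ 2 + a * b - 1)
    = ((1 - a) * (1 - b)) ^+ 2 by ring.
  have := sqr_ge0 ((1 - a) * (1 - b)).
  have : (a + b - 1) ^+ 2 * (1 + a * b) <= c * (a * b) * (1 + a * b).
    by rewrite ler_wpM2r//; lra.
  lra.
have p0 : 0 <= a * b by rewrite mulr_ge0.
have : 0 <= c * (a * b) by rewrite mulr_ge0.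
by move=> h _; nra.
Qed.

(* The line [61/100 + 2 c] is chosen to leave slack both here and in
   [ellipse_range]. *)
Lemma removal_range (R : realFieldType) (C c : R) : 0 <= c -> c <= C -> C <= 1 ->
  16 < (1 + C ^+ 2) * (4 - C - c) ^+ 2 -> 61%:R / 100%:R + 2 * c <= C.
Proof.
move=> c0 cC C1; apply: contraTT; rewrite -!ltNge -leNgt => hC.
have [C6|C6] := lerP C (61%:R / 100%:R).
  apply: (@le_trans _ _ ((1 + C ^+ 2) * (4 - C) ^+ 2)).
    apply: ler_wpM2l; first by rewrite addr_ge0// sqr_ge0.
    by rewrite ler_sqr ?nnegrE; lra.
  have g : -8%:R + 17%:R * C - 8%:R * C ^+ 2 + C ^+ 3 <= 0.
    have : C ^+ 3 <= C ^+ 2 * (61%:R / 100%:R) by rewrite exprSr ler_wpM2l ?sqr_ge0.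
    have := sqr_ge0 C; nra.
  have : C * (-8%:R + 17%:R * C - 8%:R * C ^+ 2 + C ^+ 3) <= 0.
    by apply: mulr_ge0_le0 => //; lra.
  lra.
(* The negated goal gives [c > (C - 61/100) / 2], so [4 - C - c] lies below this affine function of
   [C]. *)
apply: (@le_trans _ _ ((1 + C ^+ 2) * (4305%:R / 1000%:R - 3%:R / 2 * C) ^+ 2)).
  apply: ler_wpM2l; first by rewrite addr_ge0// sqr_ge0.
  by rewrite ler_sqr ?nnegrE; lra.
(* on [l, r] replace [C ^+ 2] by its chord and apply AM-GM to the product of
   three affine factors *)
have chord (l r x : R) : 0 <= l -> l <= C <= r -> 0 <= x -> x = 1 - l * r + (l + r) * C ->
  27%:R * ((1 + C ^+ 2) * ((l + r) / 3%:R * (4305%:R / 1000%:R - 3%:R / 2 * C)) ^+ 2)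
    <= (1 - l * r + 2 * ((l + r) / 3%:R * (4305%:R / 1000%:R))) ^+ 3.
  move=> l0 /andP[lC Cr] x0 xE.
  set v := (l + r) / 3%:R * (4305%:R / 1000%:R - 3%:R / 2 * C).
  have v0 : 0 <= v by apply: mulr_ge0; lra.
  have -> : 1 - l * r + 2 * ((l + r) / 3%:R * (4305%:R / 1000%:R)) = x + 2 * v.
    by rewrite xE /v; field.
  have : 0 <= (C - l) * (r - C) * v ^+ 2.
    by rewrite mulr_ge0 ?sqr_ge0// mulr_ge0; lra.
  have : 0 <= (x - v) ^+ 2 * (x + 8%:R * v).
    by rewrite mulr_ge0 ?sqr_ge0//; lra.
  rewrite xE; lra.
have [h|h] := lerP C (80%:R / 100%:R).
  have := @chord (61%:R / 100%:R) (80%:R / 100%:R) _ _ _ _ erefl; lra.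
have := @chord (80%:R / 100%:R) 1 _ _ _ _ erefl; lra.
Qed.

(** Numerical input for the Gram bound when deletion fails: together with [6 m^2 <= 25 balanced m]
    it yields [(1 + c) (4 - C - c)^2 m^2 <= 16 (3 - c) balanced m]. *)
Lemma ellipse_range (R : realFieldType) (C c : R) : 0 <= c -> c <= C -> C <= 1 ->
  16 < (1 + C ^+ 2) * (4 - C - c) ^+ 2 ->
  25%:R * ((1 + c) * (4 - C - c) ^+ 2) <= 96%:R * (3%:R - c).
Proof.
move=> c0 cC C1 /(removal_range c0 cC C1) hC.
apply: (@le_trans _ _ (25%:R * ((1 + c) * (339%:R / 100%:R - 3%:R * c) ^+ 2))).
  apply: ler_wpM2l => //; apply: ler_wpM2l; first lra.
  by rewrite ler_sqr ?nnegrE; lra.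
have c2 : c <= 195%:R / 1000%:R by lra.
have : c ^+ 3 <= c ^+ 2 * (195%:R / 1000%:R) by rewrite exprSr ler_wpM2l ?sqr_ge0.
have := sqr_ge0 c; lra.
Qed.

(** Used for three indices, where the sum over unordered pairs is at most [d^2 (2 + C^2)], [d] being
    the largest wedge. *)
Lemma triple_range (R : realFieldType) (C c : R) : 0 <= C <= 1 -> 0 <= c <= 1 ->
  (2 + C ^+ 2) * (4 - C - c) ^+ 2 <= 32%:R.
Proof.
move=> /andP[C0 C1] /andP[c0 c1].
apply: (@le_trans _ _ ((2 + C ^+ 2) * (4 - C) ^+ 2)).
  apply: ler_wpM2l; first by rewrite addr_ge0// sqr_ge0.
  by rewrite ler_sqr ?nnegrE; lra.
have : 0 <= C * (1 - C) ^+ 2 by rewrite mulr_ge0 ?sqr_ge0.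
have C2 : C ^+ 2 <= C by rewrite expr2 ler_piMr.
have : C ^+ 4 <= C.
  rewrite (_ : C ^+ 4 = C ^+ 2 * C ^+ 2); last by rewrite -exprD.
  by apply: (le_trans _ C2); rewrite ler_piMr ?sqr_ge0//; lra.
lra.
Qed.

(** * Sums of squared wedge products *)

Section Removal.
Variables (R : realFieldType) (I : finType) (f : I -> I -> R).
Hypothesis fC : forall i j, f i j = f j i.
Hypothesis f0 : forall i, f i i = 0.

(** Ordered pairs are summed: for symmetric [f] each unordered pair counts twice, whence the factors
    2 below. *)
Definition pair_sum (A : {set I}) : R := \sum_(i in A) \sum_(j in A) f i j.

Lemma pair_sum_setD1 (A : {set I}) i : i \in A ->
  pair_sum A = pair_sum (A :\ i) + 2 * \sum_(k in A :\ i) f k i.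
Proof.
move=> iA; rewrite /pair_sum (big_setD1 i)//= (big_setD1 i)//= f0 add0r.
under [X in _ + X = _]eq_bigr => k _ do rewrite (big_setD1 i)//=.
rewrite big_split /= addrA addrC; congr (_ + _).
under eq_bigr => k _ do rewrite fC.
by rewrite mulrDl mul1r.
Qed.

Lemma pair_sum_setD2 (A : {set I}) i j : i \in A -> j \in A -> i != j ->
  pair_sum A = pair_sum (A :\ i :\ j) +
    2 * (f i j + \sum_(k in A :\ i :\ j) (f k i + f k j)).
Proof.
move=> iA jA ij; rewrite (pair_sum_setD1 iA).
have jA' : j \in A :\ i by rewrite !inE eq_sym ij.
rewrite (pair_sum_setD1 jA') (big_setD1 j jA') /= big_split /= (fC i j).
by ring.
Qed.

Lemma pair_sum_small (A : {set I}) : (#|A| <= 1)%N -> pair_sum A = 0.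
Proof.
rewrite /pair_sum leq_eqVlt ltnS leqn0 cards_eq0 => /orP[/cards1P[i ->]|/eqP->].
  by rewrite !big_set1 f0.
by rewrite big_set0.
Qed.

(** This is [floor (n^2 / 4)], the number of edges of the balanced complete bipartite graph. *)
Definition balanced (n : nat) : nat := (n./2 * uphalf n)%N.

(** The increment matches the cost of a deletion: one for the pair itself and one for each of the
    [n] remaining vertices. *)
Lemma balanced2 n : balanced n.+2 = (balanced n + n.+1)%N.
Proof.
rewrite /balanced /= mulnS mulSn.
have : (n./2 + uphalf n = n)%N by rewrite uphalf_half addnCA addnn odd_double_half.
by lia.
Qed.

(* Mantel-type induction: deleting the pair [i, j] costs at most
   [c * (#|A| - 1)]. *)
Lemma pair_sum_removal (c : R) : 0 <= c ->
  (forall A : {set I}, (1 < #|A|)%N ->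
    pair_sum A <= 2 * (c * (balanced #|A|)%:R) \/
    exists i j, [/\ i \in A, j \in A, i != j, f i j <= c &
      forall k, k \in A -> f k i + f k j <= c]) ->
  forall A, pair_sum A <= 2 * (c * (balanced #|A|)%:R).
Proof.
move=> c0 H A; move nA : #|A| => n.
elim/ltn_ind: n A nA => n IH A nA.
have [nA1|nA1] := leqP #|A| 1.
  by rewrite pair_sum_small// mulr_ge0// mulr_ge0.
have [|[i [j [iA jA ij fij fk]]]] := H A nA1; first by rewrite nA.
have jA' : j \in A :\ i by rewrite !inE eq_sym ij.
have cA : #|A :\ i :\ j|.+2 = n by rewrite -nA (cardsD1 i A) iA (cardsD1 j (A :\ i)) jA'.
have := IH _ _ (A :\ i :\ j) erefl; rewrite -cA => /(_ (leqnSn _)) hA.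
rewrite (pair_sum_setD2 iA jA ij) balanced2.
have : \sum_(k in A :\ i :\ j) (f k i + f k j) <= c * #|A :\ i :\ j|%:R.
  rewrite mulr_natr -sumr_const; apply: ler_sum => k.
  by rewrite !inE => /andP[_ /andP[_ /fk]].
move: hA fij; set m := #|_ :\ j|; rewrite natrD -[m.+1%:R]natr1; lra.
Qed.

End Removal.

(** * Wedge products in the plane and the bound for projections *)

Section Plane.
Variables (R : realFieldType) (n : nat) (u v : 'I_n -> R).

Definition wedge i j := u i * v j - u j * v i.

Lemma exists_max_wedge (A : {set 'I_n}) : (0 < #|A|)%N ->
  exists i j, [/\ i \in A, j \in A &
    forall k l, k \in A -> l \in A -> `|wedge k l| <= `|wedge i j|].
Proof.
case/card_gt0P => x xA.
have P0 : [pred p | (p.1 \in A) && (p.2 \in A)] (x, x) by rewrite /= xA.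
case: (@Order.TotalTheory.arg_maxP _ _ _ (x, x) _ (fun p => `|wedge p.1 p.2|) P0).
move=> [i j] /= /andP[iA jA] h; exists i, j; split => // k l kA lA.
by apply: (h (k, l)); rewrite /= kA.
Qed.

Lemma wedgeC i j : wedge i j = - wedge j i. Proof. rewrite /wedge; ring. Qed.
Lemma wedgexx i : wedge i i = 0. Proof. rewrite /wedge; ring. Qed.

Lemma wedge2C i j : wedge i j ^+ 2 = wedge j i ^+ 2.
Proof. by rewrite wedgeC sqrrN. Qed.

Lemma wedge2xx i : wedge i i ^+ 2 = 0.
Proof. by rewrite wedgexx expr0n. Qed.

Lemma pair_sum_eq0 (A : {set 'I_n}) :
  (forall k l, k \in A -> l \in A -> wedge k l = 0) ->
  pair_sum (fun i j => wedge i j ^+ 2) A = 0.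
Proof.
move=> h; rewrite /pair_sum big1// => i iA; rewrite big1// => j jA.
by rewrite h// expr0n.
Qed.

(** Here [a] stands for half the area of the hull. Deleting a maximal pair works as soon as the
    other two wedges [y], [z] of each triangle satisfy [y^2 + z^2 <= a^2]. *)
Lemma hull_bound (a : R) : 0 <= a ->
  (forall i j, `|wedge i j| <= a) ->
  (forall i j k, wedge i j != 0 ->
     `|wedge i j| + `|wedge k i| + `|wedge k j| <= 2 * a) ->
  pair_sum (fun i j => wedge i j ^+ 2) [set: 'I_n] <=
    2 * (a ^+ 2 * (balanced n)%:R).
Proof.
move=> a0 h2 h3.
have sq (x : R) : x ^+ 2 = `|x| ^+ 2 by rewrite real_normK ?num_real.
rewrite -[in leRHS](card_ord n) -cardsT.
apply: (pair_sum_removal wedge2C wedge2xx); first exact: sqr_ge0.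
move=> A A1.
have [i [j [iA jA mx]]] := exists_max_wedge (ltnW A1).
have [d0|d0] := eqVneq (wedge i j) 0.
  left; rewrite pair_sum_eq0 ?mulr_ge0 ?sqr_ge0// => k l kA lA.
  by apply/eqP; have := mx k l kA lA; rewrite d0 normr0 normr_le0.
right; exists i, j; split => //.
- by apply: contra_neq d0 => ->; rewrite wedgexx.
- by rewrite sq ler_sqr ?nnegrE.
move=> k kA; have := h3 i j k d0; have := h2 i j.
have := mx k j kA jA; have := mx k i kA iA.
rewrite (sq (wedge k i)) (sq (wedge k j)).
move: (normr_ge0 (wedge k i)) (normr_ge0 (wedge k j)).
move: `|wedge i j| `|wedge k i| `|wedge k j| => x y z y0 z0 yx zx xa s.
(* As [y, z <= x], one has [y^2 + z^2 <= x^2 + (y + z - x)^2]. If [y + z > x], then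
   [y + z - x <= 2 (a - x)] bounds this by [a^2] whenever [3 a <= 5 x]; for smaller [x] the crude
   bound [2 x^2] suffices. *)
have yz : 0 <= (x - y) * (x - z) by apply: mulr_ge0; lra.
have [sx|sx] := lerP (y + z) x; first by nra.
have [xl|xl] := lerP (3%:R * a) (5%:R * x).
  have : (y + z - x) ^+ 2 <= (2 * a - 2 * x) ^+ 2.
    by rewrite ler_sqr ?nnegrE; lra.
  have : 0 <= (a - x) * (5%:R * x - 3%:R * a) by apply: mulr_ge0; lra.
  lra.
have : y ^+ 2 <= x ^+ 2 by rewrite ler_sqr ?nnegrE//; lra.
have : z ^+ 2 <= x ^+ 2 by rewrite ler_sqr ?nnegrE//; lra.
have : x ^+ 2 <= (3%:R / 5%:R * a) ^+ 2 by rewrite ler_sqr ?nnegrE//; lra.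
have := sqr_ge0 a; lra.
Qed.

End Plane.

(** Lagrange's identity, that is, Cauchy-Binet for two rows; ordered pairs double the Gram
    determinant. *)
Lemma sum_wedge_gram (R : realFieldType) (I : finType) (A : {set I}) (a b : I -> R) :
  \sum_(i in A) \sum_(j in A) (a i * b j - a j * b i) ^+ 2 =
  2 * ((\sum_(i in A) a i ^+ 2) * (\sum_(i in A) b i ^+ 2)
       - (\sum_(i in A) a i * b i) ^+ 2).
Proof.
have E i : \sum_(j in A) (a i * b j - a j * b i) ^+ 2 =
   a i ^+ 2 * (\sum_(j in A) b j ^+ 2) + b i ^+ 2 * (\sum_(j in A) a j ^+ 2)
   - 2 * (a i * b i) * (\sum_(j in A) a j * b j).
  rewrite !mulr_sumr -big_split /= -sumrB; apply: eq_bigr => j _; ring.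
under eq_bigr => i _ do rewrite E.
rewrite sumrB big_split /= -!mulr_suml -mulr_sumr; ring.
Qed.

(* The points lie in the ellipse [x^2 + y^2 - t x y <= V]: compare the trace
   and the determinant of their Gram matrix in the metric of this ellipse. *)
Lemma gram_le_ellipse (R : realFieldType) (I : finType) (A : {set I})
    (a b : I -> R) (t V : R) : `|t| <= 2 ->
  (forall i, i \in A -> a i ^+ 2 + b i ^+ 2 - t * (a i * b i) <= V) ->
  (4 - t ^+ 2) * ((\sum_(i in A) a i ^+ 2) * (\sum_(i in A) b i ^+ 2)
       - (\sum_(i in A) a i * b i) ^+ 2) <= (V * #|A|%:R) ^+ 2.
Proof.
rewrite ler_norml => /andP[t1 t2] hV.
have : \sum_(i in A) (a i ^+ 2 + b i ^+ 2 - t * (a i * b i)) <= V * #|A|%:R.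
  by rewrite mulr_natr -sumr_const; exact: ler_sum.
have : 0 <= \sum_(i in A) (a i ^+ 2 + b i ^+ 2 - t * (a i * b i)).
  apply: sumr_ge0 => i _.
  have -> : a i ^+ 2 + b i ^+ 2 - t * (a i * b i) =
    ((2 - t) * (a i + b i) ^+ 2 + (2 + t) * (a i - b i) ^+ 2) / 4 by field.
  by rewrite divr_ge0// addr_ge0// mulr_ge0 ?sqr_ge0//; lra.
rewrite sumrB big_split /= -mulr_sumr.
set p := \sum_(i in A) a i ^+ 2; set q := \sum_(i in A) b i ^+ 2.
set r := \sum_(i in A) _ => h0 h1.
apply: (@le_trans _ _ ((p + q - t * r) ^+ 2)).
  rewrite -subr_ge0.
  have -> : (p + q - t * r) ^+ 2 - (4 - t ^+ 2) * (p * q - r ^+ 2) =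
    ((2 - t) * (2 + t) * (p - q) ^+ 2 + (4 * r - t * (p + q)) ^+ 2) / 4 by field.
  by rewrite divr_ge0// addr_ge0 ?sqr_ge0// mulr_ge0 ?sqr_ge0// mulr_ge0; lra.
by rewrite ler_sqr ?nnegrE//; lra.
Qed.

(** Equality holds at 5. The inequality fails at 3, so sets of three indices need a separate
    argument. *)
Lemma balanced_ge n : (4 <= n)%N -> (6 * n ^ 2 <= 25 * balanced n)%N.
Proof.
move=> n4; rewrite /balanced uphalf_half; have := odd_double_half n.
rewrite -muln2; move: n4; case: (odd n) => /= n4; move: n./2 => h hE; nia.
Qed.

Lemma exists_max_set (R : realFieldType) (I : finType) (A : {set I}) (F : I -> R) x :
  x \in A -> exists2 i, i \in A & forall k, k \in A -> F k <= F i.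
Proof.
move=> xA; case: (@Order.TotalTheory.arg_maxP _ _ _ x (mem A) F xA) => i iA h.
by exists i.
Qed.

(** * The bound for sections of the cube *)

Section SectionBound.
Variables (R : realFieldType) (n : nat) (u v : 'I_n -> R) (B : R).
Local Notation wedge := (wedge u v).
Hypothesis B0 : 0 < B.
(** [B] stands for the area of the section, and [a m], [b m] are the coordinates of [w_m] in the
    basis [w_i, w_j]. The indices [k] and [l] cut one pair of opposite corners of the square
    each. *)
Hypothesis cut_bound : forall i j k l, wedge i j != 0 ->
  let a m := wedge m j / wedge i j in let b m := wedge i m / wedge i j in
  `|a k| <= 1 -> `|b k| <= 1 -> `|a l| <= 1 -> `|b l| <= 1 ->
  0 <= a k * b k -> a l * b l <= 0 ->
  B * `|wedge i j| <= 4 - corner_cut (a k) (b k) - corner_cut (a l) (b l).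

Lemma section_removal (A : {set 'I_n}) : (1 < #|A|)%N ->
  let f i j := wedge i j ^+ 2 in let c := (4 / B) ^+ 2 in
  pair_sum f A <= 2 * (c * (balanced #|A|)%:R) \/
  exists i j, [/\ i \in A, j \in A, i != j, f i j <= c &
      forall k, k \in A -> f k i + f k j <= c].
Proof.
move=> A1 f c.
have c0 : 0 <= c := sqr_ge0 _.
have [i [j [iA jA mx]]] := exists_max_wedge u v (ltnW A1).
have [d0|d0] := eqVneq (wedge i j) 0.
  left; rewrite pair_sum_eq0; first by rewrite mulr_ge0// mulr_ge0.
  by move=> k l kA lA; apply/eqP; have := mx k l kA lA; rewrite d0 normr0 normr_le0.
have ij : i != j by apply: contra_neq d0 => ->; rewrite wedgexx.
have d0' : 0 < `|wedge i j| by rewrite normr_gt0.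
pose d := wedge i j.
pose a m := wedge m j / d; pose b m := wedge i m / d.
have a1 m : m \in A -> `|a m| <= 1.
  by move=> mA; rewrite normrM normfV ler_pdivrMr// mul1r mx.
have b1 m : m \in A -> `|b m| <= 1.
  by move=> mA; rewrite normrM normfV ler_pdivrMr// mul1r mx.
have iP : a i * b i = 0 by rewrite /b wedgexx mul0r mulr0.
(* The product for [i] is zero, so [i] belongs to both sign classes and both maxima exist: [k] and
   [l] make the deepest cut on the two pairs of opposite corners. *)
have [|k] := @exists_max_set R _ [set m in A | 0 <= a m * b m]
  (fun m => corner_cut (a m) (b m)) i; first by rewrite inE iA iP lexx.
rewrite inE => /andP[kA kP] kmax.
have [|l] := @exists_max_set R _ [set m in A | a m * b m <= 0]
  (fun m => corner_cut (a m) (b m)) i; first by rewrite inE iA iP lexx.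
rewrite inE => /andP[lA lP] lmax.
set ck := corner_cut (a k) (b k) in kmax; set cl := corner_cut (a l) (b l) in lmax.
have area : B * `|d| <= 4 - ck - cl.
  by apply: cut_bound => //; rewrite -/d; [exact: a1|exact: b1|exact: a1|exact: b1].
pose C := Num.max ck cl; pose c' := Num.min ck cl.
have Cc : ck + cl = C + c' by rewrite /C /c'; case: (lerP ck cl) => _; rewrite addrC.
have cutb m : m \in A -> 0 <= corner_cut (a m) (b m) <= 1.
  by move=> mA; rewrite corner_cut_ge0 corner_cut_le1 ?a1 ?b1.
have /andP[ck0 ck1] := cutb _ kA; have /andP[cl0 cl1] := cutb _ lA.
have c'0 : 0 <= c' by rewrite le_min ck0.
have c'C : c' <= C by rewrite /C /c'; case: (lerP ck cl) => // /ltW.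
have C1 : C <= 1 by rewrite ge_max ck1.
have cutC m : m \in A -> corner_cut (a m) (b m) <= C.
  move=> mA; rewrite le_max; have [h|h] := lerP 0 (a m * b m).
    by rewrite kmax ?inE ?mA.
  by rewrite lmax ?inE ?mA ?(ltW h)// orbT.
have mass m : m \in A -> a m ^+ 2 + b m ^+ 2 <= 1 + C ^+ 2.
  move=> mA; apply: le_trans (sum_sqr_le_cut (a1 _ mA) (b1 _ mA)) _.
  rewrite lerD2l ler_sqr ?nnegrE ?corner_cut_ge0//; first exact: cutC.
  exact: le_trans c'C.
have fE m : f m i + f m j = d ^+ 2 * (a m ^+ 2 + b m ^+ 2).
  rewrite /f (wedge2C _ _ m i) addrC /a /b; by field.
have Bd : B ^+ 2 * d ^+ 2 <= (4 - C - c') ^+ 2.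
  rewrite -exprMn -[leLHS]real_normK ?num_real//.
  by rewrite ler_sqr ?nnegrE// ?normrM ?(gtr0_norm B0); lra.
have cB x : (x <= c) = (B ^+ 2 * x <= 16).
  rewrite /c expr_div_n ler_pdivlMr ?exprn_gt0// mulrC.
  by have -> : 4 ^+ 2 = 16 :> R by ring.
have dc : f i j <= c.
  rewrite cB; apply: le_trans Bd _.
  rewrite (_ : 16 = 4 ^+ 2 :> R); last by ring.
  by rewrite ler_sqr ?nnegrE; lra.
(* Deletion costs at most [d^2 (1 + C^2)] per remaining index, and [B |d| <= 4 - C - c']; the first
   case therefore keeps this cost below [(4 / B)^2]. In the second case the whole sum is bounded at
   once. *)
have [small|big] := lerP ((1 + C ^+ 2) * (4 - C - c') ^+ 2) 16.
  right; exists i, j; split => // m mA.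
  rewrite fE cB mulrA; apply: le_trans small; rewrite mulrC.
  apply: ler_pM (mass _ mA) Bd; first by rewrite addr_ge0 ?sqr_ge0.
  by rewrite mulr_ge0 ?sqr_ge0.
left.
have fC x y : f x y = f y x by rewrite /f wedge2C.
have f0 x : f x x = 0 by rewrite /f wedgexx expr0n.
(* Two or three indices are handled by hand, since the Gram estimate relies on [balanced_ge]. *)
have [A4|A4] := ltnP #|A| 4.
  rewrite (pair_sum_setD2 fC f0 iA jA ij).
  have jA' : j \in A :\ i by rewrite !inE eq_sym ij.
  have cA : #|A :\ i :\ j|.+2 = #|A| by rewrite (cardsD1 i A) iA (cardsD1 j (A :\ i)) jA'.
  have A2 : (#|A :\ i :\ j| <= 1)%N by rewrite -2!ltnS cA.
  rewrite pair_sum_small ?add0r//.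
  rewrite ler_pM2l//.
  have [/eqP|[m mE]] := set_0Vmem (A :\ i :\ j).
    rewrite -cards_eq0 => /eqP E0; rewrite -cA E0 /= mulr1.
    by move/eqP: E0; rewrite cards_eq0 => /eqP ->; rewrite big_set0 addr0.
  have E1 : #|A :\ i :\ j| = 1%N.
    apply/eqP; rewrite eqn_leq A2 /= card_gt0.
    by apply/set0Pn; exists m.
  have /cards1P[m' mE'] : #|A :\ i :\ j| == 1%N by rewrite E1.
  have mA : m' \in A.
    have : m' \in A :\ i :\ j by rewrite mE' set11.
    by rewrite !inE => /andP[_ /andP[_]].
  rewrite mE' big_set1 fE -cA E1 -ler_pdivrMr//= cB.
  apply: (@le_trans _ _ ((2 + C ^+ 2) * (4 - C - c') ^+ 2 / 2)); last first.
    rewrite ler_pdivrMr//; apply: le_trans (triple_range _ _) _; last by lra.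
      by rewrite C1 (le_trans c'0).
    by rewrite c'0 (le_trans c'C).
  have -> : B ^+ 2 * ((f i j + d ^+ 2 * (a m' ^+ 2 + b m' ^+ 2)) / 2%:R) =
    (1 + (a m' ^+ 2 + b m' ^+ 2)) * (B ^+ 2 * d ^+ 2) / 2.
    by rewrite /f -/d; field.
  rewrite ler_pM2r ?invr_gt0//; apply: (ler_pM _ _ _ Bd); last by have := mass _ mA; lra.
    by rewrite addr_ge0// addr_ge0 ?sqr_ge0.
  by rewrite mulr_ge0 ?sqr_ge0.
(* The sign of [t] directs the long axis of the ellipse towards the corners with the deeper cut; the
   shallower cut [c'] then controls the remaining points. *)
have ell : exists2 t, `|t| = 1 - c' &
    forall m, m \in A -> a m ^+ 2 + b m ^+ 2 - t * (a m * b m) <= 1 + c'.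
  have c'1 : 0 <= c' <= 1 by rewrite c'0 (le_trans c'C).
  have nt : `|1 - c'| = 1 - c' by rewrite ger0_norm//; lra.
  have [kl|kl] := lerP cl ck.
    have c'E : c' = cl by rewrite /c' min_r.
    exists (1 - c') => // m mA; have [h|h] := lerP 0 (a m * b m).
      by apply: ellipse_opposite; rewrite ?a1 ?b1.
    apply: ellipse_cut; rewrite ?a1 ?b1 ?(ltW h)// c'E.
    by apply: lmax; rewrite inE mA ltW.
  have c'E : c' = ck by rewrite /c' min_l// ltW.
  exists (- (1 - c')); first by rewrite normrN.
  move=> m mA.
  have -> : a m ^+ 2 + b m ^+ 2 - - (1 - c') * (a m * b m) =
    a m ^+ 2 + (- b m) ^+ 2 - (1 - c') * (a m * - b m) by ring.
  have [h|h] := lerP 0 (a m * b m).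
    apply: ellipse_cut; rewrite ?normrN ?a1 ?b1 ?mulrN ?oppr_le0//.
    rewrite c'E /corner_cut normrN -/(corner_cut (a m) (b m)).
    by apply: kmax; rewrite inE mA.
  by apply: ellipse_opposite; rewrite ?normrN ?a1 ?b1// mulrN oppr_ge0 ltW.
have [t tE ht] := ell.
have t2 : `|t| <= 2 by rewrite tE; lra.
have := gram_le_ellipse t2 ht.
have -> : pair_sum f A = d ^+ 2 * (2 * ((\sum_(i in A) a i ^+ 2) * (\sum_(i in A) b i ^+ 2)
       - (\sum_(i in A) a i * b i) ^+ 2)).
  rewrite -sum_wedge_gram /pair_sum mulr_sumr; apply: eq_bigr => x _.
  rewrite mulr_sumr; apply: eq_bigr => y _.
  rewrite /f -exprMn; congr (_ ^+ 2).
  by rewrite /a /b /d /wedge; field.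
set G := _ * _ - _ ^+ 2.
rewrite -(real_normK (num_real t)) tE => hG.
(* Since [4 - (1 - c')^2 = (1 + c') (3 - c')], one factor [1 + c'] cancels. *)
have hG' : (3 - c') * G <= (1 + c') * #|A|%:R ^+ 2.
  rewrite -(ler_pM2l (_ : 0 < 1 + c')); last lra.
  by apply: le_trans (_ : _ <= (4 - (1 - c') ^+ 2) * G) _; last (apply: le_trans hG _); lra.
have G0 : 0 <= G.
  have : 0 <= 2 * G.
    by rewrite -sum_wedge_gram sumr_ge0// => x _; rewrite sumr_ge0// => y _; exact: sqr_ge0.
  lra.
rewrite mulrCA ler_pM2l// mulrC.
have q : 6 * #|A|%:R ^+ 2 <= 25 * (balanced #|A|)%:R :> R.
  by rewrite -natrX -!natrM ler_nat balanced_ge.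
have er := ellipse_range c'0 c'C C1 big.
rewrite /c expr_div_n mulrAC ler_pdivlMr ?exprn_gt0//.
have c3 : 0 < 3 - c' by lra.
rewrite -(ler_pM2l c3).
apply: (@le_trans _ _ ((1 + c') * #|A|%:R ^+ 2 * (4 - C - c') ^+ 2)).
  have -> : (3 - c') * (G * d ^+ 2 * B ^+ 2) = (3 - c') * G * (B ^+ 2 * d ^+ 2) by ring.
  apply: ler_pM hG' Bd; rewrite mulr_ge0 ?sqr_ge0//; lra.
have : 0 <= (96%:R * (3%:R - c') - 25%:R * ((1 + c') * (4 - C - c') ^+ 2)) * #|A|%:R ^+ 2.
  by rewrite mulr_ge0 ?sqr_ge0//; lra.
have : 0 <= (3 - c') * (25 * (balanced #|A|)%:R - 6 * #|A|%:R ^+ 2).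
  by rewrite mulr_ge0//; lra.
lra.
Qed.

Lemma section_bound :
  pair_sum (fun i j => wedge i j ^+ 2) [set: 'I_n] <=
    2 * ((4 / B) ^+ 2 * (balanced n)%:R).
Proof.
rewrite -[in leRHS](card_ord n) -cardsT.
apply: (pair_sum_removal (wedge2C u v) (wedge2xx u v)); first exact: sqr_ge0.
exact: section_removal.
Qed.

End SectionBound.

Local Open Scope classical_set_scope.
Local Open Scope ring_scope.

(** * Areas in the plane *)

(** By uniqueness of Lebesgue measure: [|s|] times its push-forward under [y |-> s y + r] agrees
    with it on half-open intervals. A negative [s] swaps the included endpoint, which leaves the
    length unchanged. *)
Lemma lebesgue_measure_affine (R : realType) (s r : R)
    (A : set (measurableTypeR R)) : s != 0 -> measurable A ->
  lebesgue_measure [set y : measurableTypeR R | A (s * y + r)] =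
  (`|s|^-1%:E * lebesgue_measure A)%E.
Proof.
move=> s0 mA.
have s0' : 0 < `|s| by rewrite normr_gt0.
pose f : measurableTypeR R -> measurableTypeR R := fun y => s * y + r.
have mf : measurable_fun setT f.
  by apply: measurable_funD => //; apply: measurable_funM.
pose s' : {nonneg R} := NngNum (ltW s0').
pose mu' : {measure set (measurableTypeR R) -> \bar R} :=
  mscale s' (pushforward (@lebesgue_measure R) f).
have pE X : mu' mf X = (`|s|%:E * lebesgue_measure (f @^-1` X))%E by [].
have E : forall B, measurable B -> lebesgue_measure B = mu' mf B.
  apply: lebesgue_measure_unique => _ [[a b]] _ <-.
  rewrite pE.
  have [ltab|leba] := ltP a b; last first.
    by rewrite set_itv_ge ?bnd_simp -?leNgt// preimage_set0 !measure0 mule0.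
  move: s0; rewrite neq_lt => /orP[sN|sP].
    have -> : f @^-1` `]a, b]%classic = `[(b - r) / s, (a - r) / s[%classic.
      apply/seteqP; split => y /=; rewrite !in_itv /= /f => /andP[h1 h2];
        apply/andP; split.
      - by rewrite ler_ndivrMr// mulrC; lra.
      - by rewrite ltr_ndivlMr// mulrC; lra.
      - by move: h2; rewrite ltr_ndivlMr// mulrC; lra.
      - by move: h1; rewrite ler_ndivrMr// mulrC; lra.
    rewrite !lebesgue_measure_itv /= !lte_fin ltab.
    rewrite ltr_nM2r ?invr_lt0// ltrD2r ltab -EFinB -EFinM ltr0_norm//.
    by congr EFin; field; rewrite lt_eqF.
  have -> : f @^-1` `]a, b]%classic = `](a - r) / s, (b - r) / s]%classic.
    apply/seteqP; split => y /=; rewrite !in_itv /= /f => /andP[h1 h2];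
      apply/andP; split.
    - by rewrite ltr_pdivrMr// mulrC; lra.
    - by rewrite ler_pdivlMr// mulrC; lra.
    - by move: h1; rewrite ltr_pdivrMr// mulrC; lra.
    - by move: h2; rewrite ler_pdivlMr// mulrC; lra.
  rewrite !lebesgue_measure_itv /= !lte_fin ltab.
  rewrite ltr_pM2r ?invr_gt0// ltrD2r ltab -EFinB -EFinM gtr0_norm//.
  by congr EFin; field; rewrite gt_eqF.
rewrite [in RHS](E _ mA) pE muleA -EFinM mulVf ?mul1e//.
by rewrite gt_eqF.
Qed.

Notation plane R := (measurableTypeR R * measurableTypeR R)%type.

(** Tonelli for sets: [area] integrates vertical sections by definition, and the product measure in
    the other order agrees with it on rectangles. *)
Lemma area_ysection (R : realType) (A : set (plane R)) : measurable A ->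
  area A = (\int[@lebesgue_measure R]_y lebesgue_measure (ysection A y))%E.
Proof.
move=> mA; rewrite /area.
have h (B C : set (measurableTypeR R)) : measurable B -> measurable C ->
  ((@lebesgue_measure R) \x^ (@lebesgue_measure R))%E (B `*` C) =
  (lebesgue_measure B * lebesgue_measure C)%E.
  by move=> mB mC; rewrite product_measure2E.
exact: (product_measure_unique h mA).
Qed.

Lemma measurable_affine_fun (R : realType) (a b c : R) :
  measurable_fun setT (fun p : plane R => a * p.1 + b * p.2 + c : measurableTypeR R).
Proof.
apply: measurable_funD => //; apply: measurable_funD => //;
  exact: measurable_funM.
Qed.

Lemma measurable_affine_preimage (R : realType) (a b c a' b' c' : R)
    (A : set (plane R)) : measurable A ->
  measurable [set p : plane R |
    A (a * p.1 + b * p.2 + c, a' * p.1 + b' * p.2 + c')].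
Proof.
move=> mA.
have mf : measurable_fun setT (fun p : plane R =>
   (a * p.1 + b * p.2 + c, a' * p.1 + b' * p.2 + c') : plane R).
  by apply/measurable_fun_pairP; split; exact: measurable_affine_fun.
by rewrite -[X in measurable X]setTI; exact: mf.
Qed.

(** On each vertical section the map is affine in one variable, so [lebesgue_measure_affine] applies
    under the integral. *)
Lemma area_affine_snd (R : realType) (s k r : R) (A : set (plane R)) :
  s != 0 -> measurable A ->
  area [set p : plane R | A (p.1, k * p.1 + s * p.2 + r)] =
  (`|s|^-1%:E * area A)%E.
Proof.
move=> s0 mA; rewrite /area /product_measure1 -ge0_integralZl//; last first.
  exact: measurable_fun_xsection.
apply: eq_integral => x _ /=.
rewrite -(@lebesgue_measure_affine R s (k * x + r))//; last first.
  exact: measurable_xsection.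
congr lebesgue_measure; apply/seteqP; split => y /=; rewrite /xsection /= !inE /=;
  by have -> : k * x + s * y + r = s * y + (k * x + r) by ring.
Qed.

Lemma area_affine_fst (R : realType) (s k r : R) (A : set (plane R)) :
  s != 0 -> measurable A ->
  area [set p : plane R | A (s * p.1 + k * p.2 + r, p.2)] =
  (`|s|^-1%:E * area A)%E.
Proof.
move=> s0 mA.
have mB : measurable [set p : plane R | A (s * p.1 + k * p.2 + r, p.2)].
  have := @measurable_affine_preimage R s k r 0 1 0 A mA.
  by under eq_set do rewrite mul0r add0r mul1r addr0.
rewrite !area_ysection// -ge0_integralZl//; last first.
  exact: measurable_fun_ysection.
apply: eq_integral => x _ /=.
rewrite -(@lebesgue_measure_affine R s (k * x + r))//; last first.
  exact: measurable_ysection.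
congr lebesgue_measure; apply/seteqP; split => y /=; rewrite /ysection /= !inE /=;
  by rewrite addrA.
Qed.

Lemma area_swap (R : realType) (A : set (plane R)) : measurable A ->
  area [set p : plane R | A (p.2, p.1)] = area A.
Proof.
move=> mA; rewrite [RHS]area_ysection//; exact: eq_integral.
Qed.

(** If [b' != 0], the map factors into one that changes only the second coordinate followed by one
    that changes only the first. If [b' = 0], then [b != 0] and exchanging the two output
    coordinates leads back to that case. *)
Lemma area_affine (R : realType) (a b c a' b' c' : R) (A : set (plane R)) :
  a * b' - b * a' != 0 -> measurable A ->
  area [set p : plane R |
    A (a * p.1 + b * p.2 + c, a' * p.1 + b' * p.2 + c')] =
  (`|a * b' - b * a'|^-1%:E * area A)%E.
Proof.
have gen (x y z x' y' z' : R) (B : set (plane R)) : y' != 0 ->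
    x * y' - y * x' != 0 -> measurable B ->
  area [set p : plane R |
    B (x * p.1 + y * p.2 + z, x' * p.1 + y' * p.2 + z')] =
  (`|x * y' - y * x'|^-1%:E * area B)%E.
  move=> y'0 d0 mB.
  pose C := [set p : plane R |
    B ((x - y * x' / y') * p.1 + y / y' * p.2 + (z - y * z' / y'), p.2)].
  have mC : measurable C.
    have := @measurable_affine_preimage R
      (x - y * x' / y') (y / y') (z - y * z' / y') 0 1 0 B mB.
    by under eq_set do rewrite mul0r add0r mul1r addr0.
  have -> : [set p : plane R |
      B (x * p.1 + y * p.2 + z, x' * p.1 + y' * p.2 + z')] =
    [set p : plane R | C (p.1, x' * p.1 + y' * p.2 + z')].
    apply/seteqP; split => p; rewrite /C /=;
    suff -> : (x - y * x' / y') * p.1 + y / y' * (x' * p.1 + y' * p.2 + z') +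
      (z - y * z' / y') = x * p.1 + y * p.2 + z by [];
    by field.
  have d' : x - y * x' / y' = (x * y' - y * x') / y' by field.
  rewrite area_affine_snd// area_affine_fst ?d' ?mulf_neq0 ?invr_eq0//.
  rewrite muleA -EFinM normrM normfV invfM invrK; congr (_%:E * _)%E.
  by field; rewrite !normr_eq0 y'0 d0.
move=> d0 mA; have [b'0|b'0] := eqVneq b' 0; last exact: gen.
have b0 : b != 0 by apply: contra_neq d0 => ->; rewrite b'0; ring.
have mS : measurable [set p : plane R | A (p.2, p.1)].
  have := @measurable_affine_preimage R 0 1 0 1 0 0 A mA.
  by under eq_set do rewrite !mul0r !add0r !mul1r !addr0.
have := @gen a' b' c' a b c [set p : plane R | A (p.2, p.1)] b0.
rewrite area_swap// => ->//; first by rewrite -normrN; congr (`|_|^-1%:E * _)%E; ring.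
by rewrite -oppr_eq0; apply: contra_neq d0 => <-; ring.
Qed.

(** Holds for arbitrary sets, as the integral of a nonnegative function is a supremum over simple
    functions below it and the outer measure is monotone. Thus a projection can be bounded below
    through measurable subsets. *)
Lemma le_area (R : realType) (A B : set (R * R)) : A `<=` B ->
  (area A <= area B)%E.
Proof.
move=> AB; rewrite /area /product_measure1 !ge0_integralTE//.
apply: ereal_sup_le => _ [h hA <-]; exists h => // x.
apply: le_trans (hA x) _; apply: le_outer_measure => y.
by rewrite /xsection /= !inE; exact: AB.
Qed.

Lemma area_setU_le (R : realType) (A B : set (plane R)) :
  measurable A -> measurable B -> (area (A `|` B) <= area A + area B)%E.
Proof. exact: measureU2. Qed.

Lemma area_setU (R : realType) (A B : set (plane R)) :
  measurable A -> measurable B -> (forall p, A p -> B p -> False) ->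
  area (A `|` B) = (area A + area B)%E.
Proof.
move=> mA mB AB; apply: measureU => //.
by apply/seteqP; split => p // -[Ap Bp]; exact: (AB p).
Qed.

Lemma measurable_setP_and (R : realType) (P Q : plane R -> Prop) :
  measurable [set p : plane R | P p] -> measurable [set p : plane R | Q p] ->
  measurable [set p : plane R | P p /\ Q p].
Proof. by move=> mP mQ; apply: measurableI. Qed.

Lemma measurable_halfplane (R : realType) (a b c : R) :
  measurable [set p : plane R | a * p.1 + b * p.2 + c <= 0].
Proof.
rewrite -[X in measurable X]setTI.
have := @measurable_fun_ler _ (plane R) R setT _ _
  (measurable_affine_fun a b c) (measurable_cst (0 : measurableTypeR R)).
by move=> /(_ measurableT [set true]); exact.
Qed.

Lemma measurable_open_halfplane (R : realType) (a b c : R) :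
  measurable [set p : plane R | a * p.1 + b * p.2 + c < 0].
Proof.
rewrite -[X in measurable X]setTI.
have := @measurable_fun_ltr _ (plane R) R setT _ _
  (measurable_affine_fun a b c) (measurable_cst (0 : measurableTypeR R)).
by move=> /(_ measurableT [set true]); exact.
Qed.

(** The hypotenuse is left out so that affine images can be glued along it to other pieces
    disjointly. *)
Definition triangle0 (R : realType) : set (plane R) :=
  [set p | 0 <= p.1 /\ 0 <= p.2 /\ p.1 + p.2 < 1].

Lemma measurable_triangle0 (R : realType) : measurable (@triangle0 R).
Proof.
apply: measurable_setP_and; last apply: measurable_setP_and.
- rewrite (_ : mkset _ = [set p : plane R | (-1) * p.1 + 0 * p.2 + 0 <= 0]).
    exact: measurable_halfplane.
  by apply/seteqP; split => p /=; lra.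
- rewrite (_ : mkset _ = [set p : plane R | 0 * p.1 + (-1) * p.2 + 0 <= 0]).
    exact: measurable_halfplane.
  by apply/seteqP; split => p /=; lra.
- rewrite (_ : mkset _ = [set p : plane R | 1 * p.1 + 1 * p.2 + (-1) < 0]).
    exact: measurable_open_halfplane.
  by apply/seteqP; split => p /=; lra.
Qed.

Lemma area_rectangle (R : realType) (a b c d : R) : a <= b -> c <= d ->
  area [set p : plane R | a <= p.1 <= b /\ c <= p.2 <= d] =
  ((b - a) * (d - c))%:E.
Proof.
move=> ab cd.
rewrite (_ : mkset _ = `[a, b]%classic `*` `[c, d]%classic); last first.
  by apply/seteqP; split => p /=; rewrite !in_itv.
transitivity (lebesgue_measure (`[a, b]%classic : set (measurableTypeR R)) *
    lebesgue_measure (`[c, d]%classic : set (measurableTypeR R)))%E.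
  by apply: product_measure1E; exact: measurable_itv.
rewrite !lebesgue_measure_itv /= !lte_fin.
rewrite EFinM !EFinB.
have h (x y : R) : x <= y ->
   (if (x < y)%R then y%:E - x%:E else 0)%E = (y%:E - x%:E)%E.
  by rewrite le_eqVlt => /orP[/eqP ->|->//]; rewrite ltxx -EFinB subrr.
by rewrite !h.
Qed.

Lemma area_antidiagonal (R : realType) :
  area [set p : plane R | p.1 + p.2 = 1] = 0%E.
Proof.
rewrite /area /product_measure1 integral0_eq// => x _ /=.
rewrite (_ : xsection _ x = [set 1 - x]) ?lebesgue_measure_set1//.
apply/seteqP; split => y; rewrite /xsection /= inE /=; first by move=> <-; ring.
by move=> ->; ring.
Qed.

(** The triangle, its mirror image in the centre of the unit square and the null antidiagonal cover
    that square. *)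
Lemma area_triangle0 (R : realType) : ((2^-1)%:E <= area (@triangle0 R))%E.
Proof.
have mT := @measurable_triangle0 R.
pose T' := [set p : plane R |
  triangle0 ((-1) * p.1 + 0 * p.2 + 1, 0 * p.1 + (-1) * p.2 + 1)].
have mT' : measurable T' by exact: measurable_affine_preimage.
have mD : measurable [set p : plane R | p.1 + p.2 = 1].
  rewrite (_ : mkset _ = [set p : plane R |
    1 * p.1 + 1 * p.2 + (-1) <= 0 /\ (-1) * p.1 + (-1) * p.2 + 1 <= 0]).
    by apply: measurable_setP_and; exact: measurable_halfplane.
  apply/seteqP; split => p /=; first by move=> h; split; lra.
  by move=> [h1 h2]; apply/eqP; rewrite eq_le; apply/andP; split; lra.
have aT' : area T' = area (@triangle0 R).
  have d1 : (-1) * (-1) - 0 * 0 = 1 :> R by ring.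
  by rewrite area_affine ?d1 ?oner_neq0// normr1 invr1 mul1e.
have : (1 <= area (@triangle0 R) + area T' +
    area [set p : plane R | (p.1 + p.2 = 1)%R])%E.
  have <- : area [set p : plane R | 0 <= p.1 <= 1 /\ 0 <= p.2 <= 1] = 1%E.
    by rewrite area_rectangle// subr0 mulr1.
  apply: (@le_trans _ _ (area ((@triangle0 R `|` T') `|`
    [set p : plane R | (p.1 + p.2 = 1)%R]))).
    apply: le_area => p /= [/andP[h1 h2] /andP[h3 h4]].
    rewrite /T' /triangle0 /=.
    have [h|h|h] := ltgtP (p.1 + p.2) 1.
    - by left; left; lra.
    - by left; right; lra.
    - by right.
  apply: le_trans (area_setU_le _ _) _ => //; first exact: measurableU.
  by rewrite leeD2r//; exact: area_setU_le.
rewrite area_antidiagonal aT' adde0.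
case: (area _) => [x| |//]; last by rewrite ?leey.
by rewrite -EFinD !lee_fin; lra.
Qed.

Lemma area_triangle (R : realType) (a b c a' b' c' : R) :
  a * b' - b * a' != 0 ->
  ((2^-1 / `|a * b' - b * a'|)%R%:E <= area [set p : plane R |
    triangle0 (a * p.1 + b * p.2 + c, a' * p.1 + b' * p.2 + c')%R])%E.
Proof.
move=> d0; rewrite area_affine//; last exact: measurable_triangle0.
rewrite EFinM muleC lee_pmul2l//; last by rewrite lte_fin invr_gt0 normr_gt0.
exact: area_triangle0.
Qed.

Definition corner (R : realType) (a b : R) : set (plane R) :=
  [set p | p.1 <= 1 /\ p.2 <= 1 /\ 1 < a * p.1 + b * p.2].

Lemma measurable_corner (R : realType) (a b : R) : measurable (corner a b).
Proof.
apply: measurable_setP_and; last apply: measurable_setP_and.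
- rewrite (_ : mkset _ = [set p : plane R | 1 * p.1 + 0 * p.2 + (-1) <= 0]).
    exact: measurable_halfplane.
  by apply/seteqP; split => p /=; lra.
- rewrite (_ : mkset _ = [set p : plane R | 0 * p.1 + 1 * p.2 + (-1) <= 0]).
    exact: measurable_halfplane.
  by apply/seteqP; split => p /=; lra.
- rewrite (_ : mkset _ = [set p : plane R | (- a) * p.1 + (- b) * p.2 + 1 < 0]).
    exact: measurable_open_halfplane.
  by apply/seteqP; split => p /=; lra.
Qed.

(** With [g = a + b - 1], the coordinates [a (1 - x) / g] and [b (1 - y) / g] carry the corner to
    [triangle0], with Jacobian [a b / g^2]. *)
Lemma area_corner (R : realType) (a b : R) : 0 <= a <= 1 -> 0 <= b <= 1 ->
  ((corner_cut a b / 2)%R%:E <= area (corner a b))%E.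
Proof.
move=> /andP[a0 a1] /andP[b0 b1]; rewrite /corner_cut !ger0_norm//.
case: ltP => [ab|_]; last by rewrite mul0r; apply: integral_ge0 => x _.
set g := a + b - 1.
have g0 : 0 < g by rewrite /g; lra.
have a0' : 0 < a by move: g0; rewrite /g; lra.
have b0' : 0 < b by move: g0; rewrite /g; lra.
have dE : (- a / g) * (- b / g) - 0 * 0 = a * b / g ^+ 2.
  by field; rewrite gt_eqF.
have d0 : 0 < a * b / g ^+ 2 by rewrite divr_gt0// ?mulr_gt0// exprn_gt0.
have := @area_triangle R (- a / g) 0 (a / g) 0 (- b / g) (b / g).
rewrite dE gt_eqF// gtr0_norm// => /(_ isT).
have -> : 2^-1 / (a * b / g ^+ 2) = g ^+ 2 / (a * b) / 2.
  by field; rewrite !gt_eqF.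
move=> /le_trans; apply; apply: le_area => p [/= h1 [h2 h3]].
have e1 : - a / g * p.1 + 0 * p.2 + a / g = a * (1 - p.1) / g.
  by field; rewrite gt_eqF.
have e2 : 0 * p.1 + - b / g * p.2 + b / g = b * (1 - p.2) / g.
  by field; rewrite gt_eqF.
move: h1 h2 h3; rewrite e1 e2 => h1 h2.
rewrite -[X in X < _]mulrDl ltr_pdivrMr// => h3.
move: h1 h2; do 2 rewrite pmulr_lge0 ?invr_gt0// pmulr_rge0//; move=> h1 h2.
by move: h3; rewrite /g => h3; split; [lra|split; lra].
Qed.

(** A packing argument: [S], two antipodal copies of [C1] and two reflected copies of [C2], one
    piece per corner, are disjoint inside a square of area 4. *)
Lemma square_pieces (R : realType) (S C1 C2 : set (plane R)) (x y : R) :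
  measurable S -> measurable C1 -> measurable C2 ->
  (x%:E <= area C1)%E -> (y%:E <= area C2)%E ->
  (forall p, S p -> -1 <= p.1 <= 1 /\ -1 <= p.2 <= 1) ->
  (forall p, C1 p -> 0 < p.1 <= 1 /\ 0 < p.2 <= 1) ->
  (forall p, C2 p -> 0 < p.1 <= 1 /\ 0 < p.2 <= 1) ->
  (forall p, S p -> ~ C1 (p.1, p.2)) -> (forall p, S p -> ~ C1 (- p.1, - p.2)) ->
  (forall p, S p -> ~ C2 (p.1, - p.2)) -> (forall p, S p -> ~ C2 (- p.1, p.2)) ->
  (area S <= (4 - 2 * x - 2 * y)%R%:E)%E.
Proof.
move=> mS mC1 mC2 xC1 yC2 Ssq C1q C2q S1 S2 S3 S4.
have refl (e f : R) (C : set (plane R)) : `|e * f| = 1 -> measurable C ->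
    measurable [set p : plane R | C (e * p.1 + 0 * p.2 + 0, 0 * p.1 + f * p.2 + 0)] /\
    area [set p : plane R | C (e * p.1 + 0 * p.2 + 0, 0 * p.1 + f * p.2 + 0)] = area C.
  move=> ef mC; split; first exact: measurable_affine_preimage.
  rewrite area_affine// mul0r subr0 ?ef ?invr1 ?mul1e//.
  by rewrite -normr_gt0 ef.
have refl' (e f : R) (C : set (plane R)) : `|e * f| = 1 -> measurable C ->
    measurable [set p : plane R | C (e * p.1, f * p.2)] /\
    area [set p : plane R | C (e * p.1, f * p.2)] = area C.
  by move=> ef mC; have := refl e f C ef mC;
    under eq_set do rewrite !mul0r !addr0 add0r.
have [m1 a1] := refl' (-1) (-1) C1 ltac:(by rewrite mulrNN mulr1 normr1) mC1.
have [m2 a2] := refl' 1 (-1) C2 ltac:(by rewrite mul1r normrN1) mC2.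
have [m3 a3] := refl' (-1) 1 C2 ltac:(by rewrite mulr1 normrN1) mC2.
set D1 := [set p | _] in m1 a1; set D2 := [set p | _] in m2 a2.
set D3 := [set p | _] in m3 a3.
have mU1 := measurableU _ _ mS mC1; have mU2 := measurableU _ _ mU1 m1.
have mU3 := measurableU _ _ mU2 m2.
have E : area ((((S `|` C1) `|` D1) `|` D2) `|` D3) =
    (area S + area C1 + area C1 + area C2 + area C2)%E.
  rewrite (area_setU mU3 m3); last first.
    rewrite /D3 => p [[[Sp|/C1q h]|]|].
    - by rewrite /= mul1r mulN1r; exact: S4.
    - by rewrite /= mul1r mulN1r => /C2q /=; lra.
    - by rewrite /D1 /= => /C1q /= h /C2q /=; lra.
    - by rewrite /D2 /= => /C2q /= h /C2q /=; lra.
  rewrite (area_setU mU2 m2); last first.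
    rewrite /D2 => p [[Sp|/C1q h]|].
    - by rewrite /= mul1r mulN1r; exact: S3.
    - by rewrite /= mul1r mulN1r => /C2q /=; lra.
    - by rewrite /D1 /= => /C1q /= h /C2q /=; lra.
  rewrite (area_setU mU1 m1); last first.
    rewrite /D1 => p [Sp|/C1q h]; first by rewrite /= !mulN1r; exact: S2.
    by rewrite /= !mulN1r => /C1q /=; lra.
  rewrite (area_setU mS mC1); last by move=> [p q] /S1.
  by rewrite a1 a2 a3.
have : (area S + area C1 + area C1 + area C2 + area C2 <= 4%:E)%E.
  rewrite -E; have -> : 4 = (1 - -1) * (1 - -1) :> R by ring.
  have l11 : -1 <= 1 :> R by lra.
  rewrite -(area_rectangle l11 l11).
  apply: le_area => p [[[[/Ssq//|/C1q]|]|]|]; try by move=> h /=; lra.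
  - by rewrite /D1 /= => /C1q /=; lra.
  - by rewrite /D2 /= => /C2q /=; lra.
  - by rewrite /D3 /= => /C2q /=; lra.
have nn (A : set (plane R)) : (0 <= area A)%E by apply: integral_ge0.
move: xC1 yC2 (nn S).
case: (area C1) => [c1| |]//; case: (area C2) => [c2| |]//;
  case: (area S) => [s| |]//; rewrite -?EFinD ?lee_fin; lra.
Qed.

Lemma norm_comb_abs (R : realDomainType) (a b x y : R) : 0 <= a * b ->
  `|a * x + b * y| = `| `|a| * x + `|b| * y|.
Proof.
move=> ab.
have [[-> ->]|[-> ->]] :
    (`|a| = a /\ `|b| = b) \/ (`|a| = - a /\ `|b| = - b); last 2 first.
- by [].
- by rewrite !mulNr -opprD normrN.
have [a0|a0|a0] := ltgtP 0 a.
- by left; move: ab; rewrite pmulr_rge0// => b0; rewrite !ger0_norm ?(ltW a0).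
- by right; move: ab; rewrite nmulr_rge0// => b0; rewrite !ler0_norm ?(ltW a0).
- rewrite -a0 normr0 oppr0; case: (lerP 0 b) => b0; [left|right].
    by rewrite ger0_norm.
  by rewrite ltr0_norm.
Qed.

Lemma area_le_corner_cut (R : realType) (S : set (plane R)) (a1 b1 a2 b2 : R) :
  measurable S -> S `<=` @square2 R ->
  `|a1| <= 1 -> `|b1| <= 1 -> `|a2| <= 1 -> `|b2| <= 1 ->
  0 <= a1 * b1 -> a2 * b2 <= 0 ->
  (forall p, S p -> `|a1 * p.1 + b1 * p.2| <= 1) ->
  (forall p, S p -> `|a2 * p.1 + b2 * p.2| <= 1) ->
  (area S <= (4 - corner_cut a1 b1 - corner_cut a2 b2)%R%:E)%E.
Proof.
move=> mS Ssq a1l b1l a2l b2l ab1 ab2 S1 S2.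
have cE (a b : R) : corner_cut `|a| `|b| = corner_cut a b by rewrite /corner_cut !normr_id.
have -> : 4 - corner_cut a1 b1 - corner_cut a2 b2 =
    4 - 2 * (corner_cut `|a1| `|b1| / 2) - 2 * (corner_cut `|a2| `|b2| / 2).
  by rewrite !cE; field.
have cq (a b : R) : 0 <= a <= 1 -> 0 <= b <= 1 -> forall p, corner a b p ->
    0 < p.1 <= 1 /\ 0 < p.2 <= 1.
  move=> /andP[a0 a1'] /andP[b0 b1'] p [h1 [h2 h3]].
  rewrite h1 h2 !andbT; split; rewrite ltNge; apply/negP => h.
  - have := mulr_ge0_le0 a0 h; have := ler_wpM2l b0 h2; lra.
  - have := mulr_ge0_le0 b0 h; have := ler_wpM2l a0 h1; lra.
have nn (a : R) : `|a| <= 1 -> 0 <= `|a| <= 1 by rewrite normr_ge0.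
apply: (square_pieces mS (measurable_corner _ _) (measurable_corner _ _)
  (area_corner (nn _ a1l) (nn _ b1l)) (area_corner (nn _ a2l) (nn _ b2l))).
- exact: Ssq.
- by apply: cq; exact: nn.
- by apply: cq; exact: nn.
- move=> p /S1 h [_ [_ /=]]; move: h.
  by rewrite norm_comb_abs// ler_norml => /andP[]; lra.
- move=> p /S1 h [_ [_ /=]]; move: h.
  by rewrite norm_comb_abs// ler_norml => /andP[]; lra.
(* Reflecting the second coordinate replaces [b2] by [- b2], which makes the two coefficients agree
   in sign. *)
- move=> p /S2 h [_ [_ /=]]; move: h; rewrite -(opprK b2) mulNr -mulrN.
  by rewrite norm_comb_abs ?normrN ?mulrN ?oppr_ge0// ler_norml => /andP[]; lra.
- move=> p /S2 h [_ [_ /=]]; move: h; rewrite -(opprK b2) mulNr -mulrN.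
  by rewrite norm_comb_abs ?normrN ?mulrN ?oppr_ge0// ler_norml => /andP[]; lra.
Qed.

(** * Squares, cross-polytopes and hexagons *)

Lemma measurable_square2 (R : realType) : measurable (@square2 R : set (plane R)).
Proof.
rewrite (_ : square2 (R:=R) = [set p : plane R |
  (-1 * p.1 + 0 * p.2 + -1 <= 0 /\ 1 * p.1 + 0 * p.2 + -1 <= 0) /\
  (0 * p.1 + -1 * p.2 + -1 <= 0 /\ 0 * p.1 + 1 * p.2 + -1 <= 0)]).
  by apply: measurable_setP_and; apply: measurable_setP_and;
    exact: measurable_halfplane.
apply/seteqP; split => p; rewrite /square2 /=.
  by move=> [/andP[? ?] /andP[? ?]]; split; split; lra.
by move=> [[? ?] [? ?]]; split; apply/andP; split; lra.
Qed.

Lemma area_square2 (R : realType) : area (@square2 R) = 4%:E.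
Proof.
have l11 : -1 <= 1 :> R by lra.
by rewrite /square2 area_rectangle//; congr EFin; ring.
Qed.

Lemma cross2E (R : realType) : @cross2 R =
  [set p | square2 (1 * p.1 + 1 * p.2 + 0, 1 * p.1 + -1 * p.2 + 0)].
Proof.
apply/seteqP; split => p; rewrite /cross2 /square2 /=.
  by case: (ger0P p.1) => h1; case: (ger0P p.2) => h2 h;
    split; apply/andP; split; lra.
by move=> [/andP[? ?] /andP[? ?]]; case: (ger0P p.1) => h1;
  case: (ger0P p.2) => h2; lra.
Qed.

Lemma measurable_cross2 (R : realType) : measurable (@cross2 R : set (plane R)).
Proof.
by rewrite cross2E; apply: measurable_affine_preimage; exact: measurable_square2.
Qed.

Lemma area_cross2 (R : realType) : area (@cross2 R) = 2%:E.
Proof.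
have d2 : 1 * -1 - 1 * 1 = - 2 :> R by ring.
rewrite cross2E area_affine ?d2 ?oppr_eq0 ?pnatr_eq0//; last first.
  exact: measurable_square2.
rewrite area_square2 -EFinM normrN ger0_norm//; congr EFin; by field.
Qed.

(* The triangle with vertices (1, 0), (0, 1), (a, b), without the edge
   joining the first two. *)
Definition cap (R : realType) (a b : R) : set (plane R) :=
  [set p | triangle0 ((1 - a / (a + b - 1)) * p.1 + (- a / (a + b - 1)) * p.2
                        + a / (a + b - 1),
                      (- b / (a + b - 1)) * p.1 + (1 - b / (a + b - 1)) * p.2
                        + b / (a + b - 1))].

Lemma measurable_cap (R : realType) (a b : R) : measurable (cap a b).
Proof.
by apply: measurable_affine_preimage; exact: measurable_triangle0.
Qed.

Lemma area_cap (R : realType) (a b : R) : 1 < a + b ->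
  (((a + b - 1) / 2)%R%:E <= area (cap a b))%E.
Proof.
move=> ab; have g0 : 0 < a + b - 1 by lra.
have dE : (1 - a / (a + b - 1)) * (1 - b / (a + b - 1))
    - (- a / (a + b - 1)) * (- b / (a + b - 1)) = - (a + b - 1)^-1.
  by field; rewrite gt_eqF.
have := @area_triangle R (1 - a / (a + b - 1)) (- a / (a + b - 1))
  (a / (a + b - 1)) (- b / (a + b - 1)) (1 - b / (a + b - 1)) (b / (a + b - 1)).
rewrite dE oppr_eq0 invr_eq0 gt_eqF// => /(_ isT).
rewrite normrN normfV invrK gtr0_norm// (mulrC 2^-1).
exact.
Qed.

(** The affine coordinates in [cap] are the barycentric weights of [(1, 0)] and [(0, 1)]; the
    remaining weight sits at [(a, b)]. *)
Lemma capP (R : realType) (a b : R) p : 1 < a + b -> cap a b p ->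
  exists x y : R, [/\ 0 <= x, 0 <= y, x + y < 1 &
    p = (x + (1 - x - y) * a, y + (1 - x - y) * b)].
Proof.
move=> ab; have g0 : a + b - 1 != 0 by rewrite gt_eqF//; lra.
rewrite /cap /triangle0 /=; set x := (X in 0 <= X /\ _).
set y := (X in _ /\ 0 <= X /\ _).
move=> [x0 [y0 xy]]; exists x, y; split => //.
rewrite [LHS]surjective_pairing /x /y; congr pair; by field.
Qed.

(** Antipodal caps are glued to two opposite edges of the cross-polytope. For [1 < a + b] the result
    lies in the hull of the points [+-(1, 0)], [+-(0, 1)], [+-(a, b)], which is all that a lower
    area bound requires. *)
Definition hexagon (R : realType) (a b : R) : set (plane R) :=
  @cross2 R `|` cap a b `|`
  [set p | cap a b (-1 * p.1 + 0 * p.2 + 0, 0 * p.1 + -1 * p.2 + 0)].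

Lemma measurable_hexagon (R : realType) (a b : R) : measurable (hexagon a b).
Proof.
apply: measurableU; first apply: measurableU.
- exact: measurable_cross2.
- exact: measurable_cap.
- by apply: measurable_affine_preimage; exact: measurable_cap.
Qed.

Lemma area_hexagon (R : realType) (a b : R) : 0 <= a -> 0 <= b -> 1 < a + b ->
  ((1 + a + b)%R%:E <= area (hexagon a b))%E.
Proof.
move=> a0 b0 ab.
have capD p : cap a b p -> 1 < p.1 + p.2.
  move=> /capP -/(_ ab)[x [y [x0 y0 xy ->]]] /=.
  have : 0 < (1 - x - y) * (a + b - 1) by apply: mulr_gt0; lra.
  lra.
have crossD p : @cross2 R p -> -1 <= p.1 + p.2 <= 1.
  by rewrite cross2E /square2 /= !mul1r !addr0 => -[].
have mC := @measurable_cross2 R; have mT := measurable_cap a b.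
have mN := @measurable_affine_preimage R (-1) 0 0 0 (-1) 0 _ mT.
have d1 : (-1) * (-1) - 0 * 0 = 1 :> R by ring.
rewrite /hexagon (area_setU (measurableU _ _ mC mT) mN); last first.
  by move=> p [/crossD|/capD] h /capD /=; move: h; lra.
rewrite (area_setU mC mT); last first.
  by move=> p /crossD h /capD; move: h; lra.
rewrite area_affine// d1 ?oner_neq0// normr1 invr1 mul1e area_cross2.
have := area_cap ab; case: (area _) => [x| |//]; last by move=> _; rewrite addey ?leey.
by rewrite -!EFinD !lee_fin; lra.
Qed.

Lemma hexagonP (R : realType) (a b : R) p : 1 < a + b -> hexagon a b p ->
  exists x y z : R, `|x| + `|y| + `|z| <= 1 /\ p = (x + z * a, y + z * b).
Proof.
move=> ab [[|/(capP ab)[x [y [x0 y0 xy ->]]]]|].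
- rewrite /cross2 /= => h; exists p.1, p.2, 0.
  by rewrite normr0 !mul0r !addr0 -surjective_pairing.
- exists x, y, (1 - x - y); split => //.
  by rewrite !ger0_norm//; lra.
- move=> /(capP ab)[x [y [x0 y0 xy]]] [].
  rewrite !mulN1r !mul0r add0r !addr0 => h1 h2.
  exists (- x), (- y), (- (1 - x - y)); split.
    by rewrite !normrN !ger0_norm//; lra.
  by rewrite [LHS]surjective_pairing; congr pair; lra.
Qed.

(** The assumption puts the hull of [+-p], [+-q], [+-(a p + b q)] inside [K]. The first bound comes
    from the parallelogram on [+-p, +-q], the second from the hexagon. *)
Lemma hull_area (R : realType) (K : set (R * R)) (p q : R * R) (a b : R) :
  let d := p.1 * q.2 - p.2 * q.1 in
  d != 0 ->
  (forall x y z : R, `|x| + `|y| + `|z| <= 1 ->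
    K ((x + z * a) * p.1 + (y + z * b) * q.1,
       (x + z * a) * p.2 + (y + z * b) * q.2)) ->
  ((2 * `|d|)%R%:E <= area K)%E /\
  ((`|d| * (1 + `|a| + `|b|))%R%:E <= area K)%E.
Proof.
rewrite /= => d0.
(* Moves an area bound for a model set [H] to the plane through the basis [p', q'], at the price of
   its determinant. *)
have key (H : set (plane R)) (r : R) (K' : set (R * R)) (p' q' : R * R) : measurable H ->
    p'.1 * q'.2 - p'.2 * q'.1 != 0 ->
    (r%:E <= area H)%E ->
    (forall x y, H (x, y) -> K' (x * p'.1 + y * q'.1, x * p'.2 + y * q'.2)) ->
    ((r * `|p'.1 * q'.2 - p'.2 * q'.1|)%R%:E <= area K')%E.
  move=> mH; set e := _ - _ => e0 rH HK.
  apply: (@le_trans _ _ (area [set s : plane R |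
     H (q'.2 / e * s.1 + - q'.1 / e * s.2 + 0, - p'.2 / e * s.1 + p'.1 / e * s.2 + 0)%R])).
    have dE : q'.2 / e * (p'.1 / e) - - q'.1 / e * (- p'.2 / e) = e^-1.
      by rewrite /e; field.
    rewrite area_affine ?dE ?invr_eq0// normfV invrK muleC EFinM.
    by rewrite lee_pmul2r// lte_fin normr_gt0.
  apply: le_area => s /= /HK; congr K'.
  by rewrite [RHS]surjective_pairing; congr pair; rewrite /e; field.
(* Changing the signs of [a] and [p] together preserves the hull; likewise for [b] and [q]. *)
wlog a0 : a p d0 / 0 <= a => [wh KP|].
  have [|a0] := lerP 0 a; first by move=> /wh; exact.
  have := wh (- a) (- p.1, - p.2).
  rewrite /= !mulNr -opprD oppr_eq0 !normrN; apply => //.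
    by rewrite oppr_ge0 ltW.
  move=> x y z h; have := KP (- x) y z; rewrite normrN => /(_ h).
  congr (K (_, _)); ring.
wlog b0 : b q d0 / 0 <= b => [wh KP|].
  have [|b0] := lerP 0 b; first by move=> /wh; exact.
  have := wh (- b) (- q.1, - q.2).
  rewrite /= !mulrN -opprD oppr_eq0 !normrN; apply => //.
    by rewrite oppr_ge0 ltW.
  move=> x y z h; have := KP x (- y) z; rewrite normrN => /(_ h).
  congr (K (_, _)); ring.
move=> KP.
have two : ((2 * `|p.1 * q.2 - p.2 * q.1|)%R%:E <= area K)%E.
  apply: (key (@cross2 R)) => //; first exact: measurable_cross2.
    by rewrite area_cross2.
  move=> x y; rewrite /cross2 /= => h; have := KP x y 0.
  by rewrite normr0 !mul0r !addr0; exact.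
split=> //; rewrite (ger0_norm a0) (ger0_norm b0).
have [ab|ab] := lerP (a + b) 1.
  apply: le_trans two; rewrite lee_fin mulrC ler_wpM2r//.
  lra.
rewrite mulrC; apply: (key (hexagon a b)) => //.
- exact: measurable_hexagon.
- exact: area_hexagon.
- by move=> x y /(hexagonP ab)[x' [y' [z' [h [-> ->]]]]]; exact: KP.
Qed.

(** * Sections and projections *)

Lemma measurable_strip (R : realType) (a b : R) :
  measurable [set p : plane R | -1 <= a * p.1 + b * p.2 <= 1].
Proof.
rewrite (_ : mkset _ = [set p : plane R |
  (- a) * p.1 + (- b) * p.2 + -1 <= 0 /\ a * p.1 + b * p.2 + -1 <= 0]).
  by apply: measurable_setP_and; exact: measurable_halfplane.
apply/seteqP; split => p /=; first by move=> /andP[? ?]; split; lra.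
by move=> [? ?]; apply/andP; split; lra.
Qed.

Lemma orthonormal2_wedge (R : realType) (n : nat) (u v : 'I_n -> R) :
  orthonormal2 u v ->
  pair_sum (fun i j => wedge u v i j ^+ 2) [set: 'I_n]%SET = 2.
Proof.
move=> [uu [vv uv]]; rewrite /pair_sum /wedge sum_wedge_gram.
have E (F : 'I_n -> R) : \sum_(i in [set: 'I_n]%SET) F i = \sum_(i < n) F i.
  by apply: eq_bigl => i; rewrite inE.
by rewrite !E uu vv uv; ring.
Qed.

(** Only the constraints of [i, j, k, l] are kept. The pairings with [w_i] and [w_j] serve as
    coordinates, with Jacobian [wedge i j], and turn the first two constraints into the square. *)
Lemma area_section_le_cut (R : realType) (n : nat) (u v : 'I_n -> R)
    (i j k l : 'I_n) : wedge u v i j != 0 ->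
  let a m := wedge u v m j / wedge u v i j in
  let b m := wedge u v i m / wedge u v i j in
  `|a k| <= 1 -> `|b k| <= 1 -> `|a l| <= 1 -> `|b l| <= 1 ->
  0 <= a k * b k -> a l * b l <= 0 ->
  (area (section_coords (@cube R n) u v) <=
   ((4 - corner_cut (a k) (b k) - corner_cut (a l) (b l)) / `|wedge u v i j|)%R%:E)%E.
Proof.
move=> d0 a b ak bk al bl kP lP.
pose S : set (plane R) := [set q | square2 q /\
  (-1 <= a k * q.1 + b k * q.2 <= 1 /\ -1 <= a l * q.1 + b l * q.2 <= 1)].
have mS : measurable S.
  apply: measurable_setP_and; first exact: measurable_square2.
  by apply: measurable_setP_and; exact: measurable_strip.
have S4 : (area S <= (4 - corner_cut (a k) (b k) - corner_cut (a l) (b l))%R%:E)%E.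
  by apply: area_le_corner_cut => // p [] //; rewrite ler_norml => _ [].
apply: (@le_trans _ _ (area [set p : plane R |
    S (u i * p.1 + v i * p.2 + 0, u j * p.1 + v j * p.2 + 0)%R])).
  apply: le_area => p Kp.
  have abE m : a m * (u i * p.1 + v i * p.2) + b m * (u j * p.1 + v j * p.2) =
      p.1 * u m + p.2 * v m.
    by rewrite /a /b /wedge; field.
  rewrite /S /square2 /= !addr0 !abE !(mulrC _ p.1) !(mulrC _ p.2).
  by split; [split|split]; exact: Kp.
have dE : u i * v j - v i * u j = wedge u v i j by rewrite /wedge; ring.
rewrite area_affine ?dE// EFinM muleC lee_pmul2r//.
by rewrite lte_fin invr_gt0 normr_gt0.
Qed.

Lemma area_section_le (R : realType) (n : nat) (u v : 'I_n -> R) :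
  orthonormal2 u v ->
  (area (section_coords (@cube R n) u v) <=
   (4 * Num.sqrt (balanced n)%:R)%R%:E)%E.
Proof.
move=> ouv; have P2 := orthonormal2_wedge ouv.
have cb := @area_section_le_cut R n u v.
have q0 : 0 <= 4 * Num.sqrt (balanced n)%:R :> R by rewrite mulr_ge0 ?sqrtr_ge0.
case: (area _) cb => [B| |] cb; last by rewrite leNye.
- have [B0|B0] := lerP B 0; first by rewrite lee_fin (le_trans B0).
  rewrite lee_fin -ler_pdivrMl// -(ler_sqr) ?nnegrE ?sqrtr_ge0//; last first.
    by rewrite mulr_ge0 ?invr_ge0// ltW.
  rewrite sqr_sqrtr ?ler0n//.
  have : pair_sum (fun i j => wedge u v i j ^+ 2) [set: 'I_n]%SET <=
      2 * ((4 / B) ^+ 2 * (balanced n)%:R).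
    apply: section_bound => // i j k l d0 a b ak bk al bl kP lP.
    have := cb i j k l d0 ak bk al bl kP lP.
    by rewrite lee_fin ler_pdivlMr ?normr_gt0.
  rewrite P2 -[leLHS]mulr1 ler_pM2l// mulrC expr_div_n => h.
  rewrite exprMn exprVn -ler_pdivlMl ?exprn_gt0//.
  have B2 : 0 < B ^+ 2 by rewrite exprn_gt0.
  move: h; rewrite mulrA ler_pdivlMr// mul1r => h.
  rewrite ler_pdivlMl ?invr_gt0 ?exprn_gt0//; lra.
(* Infinite area is impossible: the squared wedges sum to 2, so some wedge is nonzero, and taking
   [k = l = i] in the cut bound gives a finite value. *)
- have [x0|[i [j d0]]] : (forall i j, wedge u v i j = 0) \/
      exists i j, wedge u v i j != 0.
    have [?|/existsNP[i /existsNP[j /eqP h]]] :=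
      pselect (forall i j, wedge u v i j = 0); [by left|right].
    by exists i, j.
  + by move: P2; rewrite pair_sum_eq0// => /eqP; rewrite eq_sym pnatr_eq0.
  + have := cb i j i i d0; rewrite /= divff// wedgexx mul0r normr1 normr0 mulr0.
    by move=> /(_ (lexx _) ler01 (lexx _) ler01 (lexx _) (lexx _)); rewrite leNgt ltry.
Qed.

Lemma area_projection_ge (R : realType) (n : nat) (u v : 'I_n -> R) :
  orthonormal2 u v ->
  ((2 / Num.sqrt (balanced n)%:R)%R%:E <=
   area (proj_coords (@cross R n) u v))%E.
Proof.
move=> ouv; have P2 := orthonormal2_wedge ouv.
have KP i j k x y z : `|x| + `|y| + `|z| <= 1 ->
    proj_coords (@cross R n) u v
      (x * u i + y * u j + z * u k, x * v i + y * v j + z * v k).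
  move=> h; have sumD (F : 'I_n -> R) m : \sum_l (l == m)%:R * F l = F m.
    rewrite (bigD1 m)//= eqxx mul1r big1 ?addr0// => l /negPf ->.
    by rewrite mul0r.
  (* The preimage is [x e_i + y e_j + z e_k]. The indices may coincide, so its norm is only
     estimated by the triangle inequality. *)
  exists (fun m => x * (m == i)%:R + y * (m == j)%:R + z * (m == k)%:R).
    apply: le_trans h.
    apply: (@le_trans _ _ (\sum_(m < n) ((m == i)%:R * `|x| +
        (m == j)%:R * `|y| + (m == k)%:R * `|z|))).
      apply: ler_sum => m _; apply: le_trans (ler_normD _ _) _.
      apply: lerD; last by rewrite normrM normr_nat mulrC.
      apply: le_trans (ler_normD _ _) _.
      by rewrite !normrM !normr_nat !(mulrC _%:R).
    by rewrite !big_split /= !(sumD (fun=> _)).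
  by congr pair; under eq_bigr => m _ do rewrite !mulrDl -!mulrA;
    rewrite !big_split /= -!mulr_sumr !sumD.
have hull i j k : wedge u v i j != 0 ->
    ((2 * `|wedge u v i j|)%R%:E <= area (proj_coords (@cross R n) u v))%E /\
    ((`|wedge u v i j| + `|wedge u v k i| + `|wedge u v k j|)%R%:E <=
      area (proj_coords (@cross R n) u v))%E.
  move=> d0; pose a := wedge u v k j / wedge u v i j.
  pose b := wedge u v i k / wedge u v i j.
  have dE : u i * v j - v i * u j = wedge u v i j by rewrite /wedge; ring.
  have := @hull_area R (proj_coords (@cross R n) u v) (u i, v i) (u j, v j) a b.
  rewrite /= dE => /(_ d0)[].
    move=> x y z /(KP i j k); congr (proj_coords _ _ _ (_, _));
      rewrite /a /b /wedge; by field.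
  move=> h1 h2; split => //; apply: le_trans h2; rewrite lee_fin.
  rewrite /a /b !normrM normfV (wedgeC u v k i) normrN.
  rewrite le_eqVlt; apply/orP; left; apply/eqP; field.
  by rewrite normr_eq0.
have nn : (0 <= area (proj_coords (@cross R n) u v))%E by apply: integral_ge0.
case: (area _) nn hull => [A| |] // A0 hull; last by rewrite leey.
rewrite lee_fin in A0.
have : pair_sum (fun i j => wedge u v i j ^+ 2) [set: 'I_n]%SET <=
    2 * ((A / 2) ^+ 2 * (balanced n)%:R).
  apply: hull_bound; first by rewrite divr_ge0.
    move=> i j; have [->|d0] := eqVneq (wedge u v i j) 0.
      by rewrite normr0 divr_ge0.
    by have [+ _] := hull i j i d0; rewrite lee_fin; lra.
  move=> i j k d0; have [_] := hull i j k d0; rewrite lee_fin; lra.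
rewrite P2 -[leLHS]mulr1 ler_pM2l// => h.
rewrite lee_fin; set s := Num.sqrt _.
have q0 : 0 <= (balanced n)%:R :> R by rewrite ler0n.
have sE : (balanced n)%:R = s ^+ 2 by rewrite sqr_sqrtr.
(* Division by zero yields zero, so the bound is trivial here. *)
have [s0|s0] := eqVneq s 0; first by rewrite s0 invr0 mulr0.
have sp : 0 < s by rewrite lt_neqAle eq_sym s0 sqrtr_ge0.
rewrite ler_pdivrMr//.
have t0 : 0 <= A / 2 * s by rewrite mulr_ge0 ?divr_ge0// ltW.
have : 1 ^+ 2 <= (A / 2 * s) ^+ 2 by rewrite expr1n exprMn -sE.
rewrite ler_sqr ?nnegrE//; lra.
Qed.

(** * The plane that attains both bounds *)

Section Extremal.
Variables (R : realType) (n : nat) (hn : (2 <= n)%N).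

(** With [uphalf_frame] this places the first [n./2] points [w_i] on one axis and the others on the
    second axis; wedges across the halves all have absolute value [1 / sqrt (balanced n)], the
    others vanish. *)
Definition half_frame : 'I_n -> R :=
  fun i => if (i < n./2)%N then (Num.sqrt (n./2)%:R)^-1 else 0.
Definition uphalf_frame : 'I_n -> R :=
  fun i => if (i < n./2)%N then 0 else (Num.sqrt (uphalf n)%:R)^-1.

Let s : R := Num.sqrt (n./2)%:R.
Let t : R := Num.sqrt (uphalf n)%:R.

Lemma half_sqrt_gt0 : 0 < s.
Proof. by rewrite sqrtr_gt0 ltr0n half_gt0. Qed.

Lemma uphalf_sqrt_gt0 : 0 < t.
Proof. by rewrite sqrtr_gt0 ltr0n uphalf_gt0 ltnW. Qed.

Lemma sqrt_balanced : Num.sqrt (balanced n)%:R = s * t.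
Proof. by rewrite /balanced natrM sqrtrM. Qed.

Lemma sum_half (x y : R) :
  \sum_(i < n) (if (i < n./2)%N then x else y) = (n./2)%:R * x + (uphalf n)%:R * y.
Proof.
have nE : n = (n./2 + uphalf n)%N.
  by rewrite uphalf_half addnCA addnn odd_double_half.
have E (k m m' : nat) : k = (m + m')%N ->
    \sum_(i < k) (if (i < m)%N then x else y) = m%:R * x + m'%:R * y.
  move=> ->; rewrite big_split_ord /=; under eq_bigr => i _ do rewrite ltn_ord.
  under [X in _ + X]eq_bigr => i _ do rewrite ltnNge leq_addr /=.
  by rewrite !sumr_const !card_ord !mulr_natl.
exact: E.
Qed.

Lemma orthonormal2_half_frame : orthonormal2 half_frame uphalf_frame.
Proof.
have s2 : s ^+ 2 = (n./2)%:R by rewrite sqr_sqrtr.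
have t2 : t ^+ 2 = (uphalf n)%:R by rewrite sqr_sqrtr.
have s0 := gt_eqF half_sqrt_gt0; have t0 := gt_eqF uphalf_sqrt_gt0.
rewrite /half_frame /uphalf_frame -/s -/t; split; last split.
- under eq_bigr => i _ do rewrite (fun_if (fun z => z ^+ 2)) expr0n /=.
  by rewrite sum_half// -s2; field; rewrite s0.
- under eq_bigr => i _ do rewrite (fun_if (fun z => z ^+ 2)) expr0n /=.
  by rewrite sum_half// -t2; field; rewrite t0.
- by rewrite big1// => i _; case: ifP; rewrite ?mulr0 ?mul0r.
Qed.

Lemma section_half_frame : section_coords (@cube R n) half_frame uphalf_frame =
  [set p | square2 (s^-1 * p.1 + 0 * p.2 + 0, 0 * p.1 + t^-1 * p.2 + 0)].
Proof.
have h0 : (0 < n)%N := ltnW hn.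
have hl : (n./2 < n)%N by rewrite ltn_half_double -addnn -[X in (X < _)%N]addn0 ltn_add2l.
apply/seteqP; split => p; rewrite /section_coords /cube /square2 /=.
  move=> K; rewrite !mul0r !addr0 add0r; split.
    have := K (Ordinal h0); rewrite /half_frame /uphalf_frame /= half_gt0 hn.
    by rewrite mulr0 addr0 mulrC.
  have := K (Ordinal hl); rewrite /half_frame /uphalf_frame /= ltnn.
  by rewrite mulr0 add0r mulrC.
rewrite !mul0r !addr0 add0r => -[K1 K2] i; rewrite /half_frame /uphalf_frame.
by case: ifP => _; rewrite mulr0 ?addr0 ?add0r mulrC.
Qed.

Lemma projection_half_frame : proj_coords (@cross R n) half_frame uphalf_frame =
  [set p | cross2 (s * p.1 + 0 * p.2 + 0, 0 * p.1 + t * p.2 + 0)].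
Proof.
have s2 : s ^+ 2 = (n./2)%:R by rewrite sqr_sqrtr.
have t2 : t ^+ 2 = (uphalf n)%:R by rewrite sqr_sqrtr.
have sp := half_sqrt_gt0; have tp := uphalf_sqrt_gt0.
apply/seteqP; split => p; rewrite /proj_coords /cross /cross2 /=.
  move=> [x x1 ->] /=; rewrite !mul0r !addr0 add0r !mulr_sumr.
  apply: le_trans x1; apply: le_trans (lerD (ler_norm_sum _ _ _) (ler_norm_sum _ _ _)) _.
  rewrite -big_split /=; apply: ler_sum => i _.
  rewrite /half_frame /uphalf_frame -/s -/t; case: ifP => _.
    by rewrite !mulr0 normr0 addr0 mulrCA divff ?mulr1// gt_eqF.
  by rewrite !mulr0 normr0 add0r mulrCA divff ?mulr1// gt_eqF.
rewrite !mul0r !addr0 add0r => p1.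
(* The preimage spreads each coordinate evenly over its half of the indices; its norm is then
   [s |p.1| + t |p.2|]. *)
exists (fun i : 'I_n => if (i < n./2)%N then p.1 / s else p.2 / t).
  under eq_bigr => i _ do rewrite (fun_if (fun z => `|z|)).
  rewrite sum_half// -s2 -t2; apply: le_trans p1.
  rewrite !normrM !normfV (gtr0_norm sp) (gtr0_norm tp) le_eqVlt; apply/orP; left; apply/eqP.
  by field; rewrite !gt_eqF.
rewrite [LHS]surjective_pairing /half_frame /uphalf_frame -/s -/t; congr pair.
  transitivity (\sum_(i < n) (if (i < n./2)%N then p.1 / s * s^-1 else 0)).
    by rewrite sum_half// -s2; field; rewrite gt_eqF.
  by apply: eq_bigr => i _; case: ifP; rewrite ?mulr0.
transitivity (\sum_(i < n) (if (i < n./2)%N then 0 else p.2 / t * t^-1)).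
  by rewrite sum_half// -t2; field; rewrite gt_eqF.
by apply: eq_bigr => i _; case: ifP; rewrite ?mulr0.
Qed.

Lemma area_section_half_frame :
  area (section_coords (@cube R n) half_frame uphalf_frame) =
  (4 * Num.sqrt (balanced n)%:R)%R%:E.
Proof.
have sp := half_sqrt_gt0; have tp := uphalf_sqrt_gt0.
have d0 : 0 < s^-1 / t - 0 * 0 by rewrite mul0r subr0 divr_gt0 ?invr_gt0.
rewrite section_half_frame area_affine ?gt_eqF//; last exact: measurable_square2.
rewrite area_square2 gtr0_norm// sqrt_balanced -EFinM; congr EFin.
by field; rewrite !gt_eqF.
Qed.

Lemma area_projection_half_frame :
  area (proj_coords (@cross R n) half_frame uphalf_frame) =
  (2 / Num.sqrt (balanced n)%:R)%R%:E.
Proof.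
have sp := half_sqrt_gt0; have tp := uphalf_sqrt_gt0.
have d0 : 0 < s * t - 0 * 0 by rewrite mul0r subr0 mulr_gt0.
rewrite projection_half_frame area_affine ?gt_eqF//; last exact: measurable_cross2.
rewrite area_cross2 gtr0_norm// sqrt_balanced -EFinM; congr EFin.
by field; rewrite !gt_eqF.
Qed.

Lemma affine_image_of_diagonal (K : set (R * R)) (x y : R) : x != 0 -> y != 0 ->
  affine_image_of K [set p | K (x * p.1 + 0 * p.2 + 0, 0 * p.1 + y * p.2 + 0)].
Proof.
move=> x0 y0; exists (0, 0), x^-1, 0, 0, y^-1.
split; first by rewrite mul0r subr0 mulf_neq0 ?invr_eq0.
apply/seteqP; split => p /=; rewrite !mul0r !addr0 ?add0r.
  move=> Kp; exists (x * p.1, y * p.2) => //=.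
  by rewrite !mul0r !add0r addr0 !mulKf// -surjective_pairing.
move=> [q Kq <-] /=; rewrite !mul0r !add0r !addr0 !mulVKf//.
by rewrite -surjective_pairing.
Qed.

End Extremal.

Theorem theorem2 (R : realType) (n : nat) (hn : (2 <= n)%N) :
  (* (a) the maximal section area of [-1,1]^n by 2-planes is attained at a
     plane whose section is an affine cube (parallelogram) *)
  (exists u0 v0 : 'I_n -> R,
     [/\ orthonormal2 u0 v0,
         affine_cube2 (section_coords (@cube R n) u0 v0) &
         forall u v : 'I_n -> R, orthonormal2 u v ->
           (area (section_coords (@cube R n) u v)
              <= area (section_coords (@cube R n) u0 v0))%E])
  /\
  (* (b) the minimal projection area of B_1^n onto 2-planes is attained at a
     plane whose projection is an affine cross-polytope *)
  (exists u0 v0 : 'I_n -> R,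
     [/\ orthonormal2 u0 v0,
         affine_cross2 (proj_coords (@cross R n) u0 v0) &
         forall u v : 'I_n -> R, orthonormal2 u v ->
           (area (proj_coords (@cross R n) u0 v0)
              <= area (proj_coords (@cross R n) u v))%E]).
Proof.
have s0 : Num.sqrt (n./2)%:R != 0 :> R by rewrite gt_eqF// half_sqrt_gt0.
have t0 : Num.sqrt (uphalf n)%:R != 0 :> R by rewrite gt_eqF// uphalf_sqrt_gt0.
split; exists (@half_frame R n), (@uphalf_frame R n); split.
- exact: orthonormal2_half_frame.
- by rewrite section_half_frame//; apply: affine_image_of_diagonal; rewrite invr_eq0.
- by move=> u v ouv; rewrite area_section_half_frame//; exact: area_section_le.
- exact: orthonormal2_half_frame.
- by rewrite projection_half_frame//; exact: affine_image_of_diagonal.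
- by move=> u v ouv; rewrite area_projection_half_frame//; exact: area_projection_ge.
Qed.
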